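(* Let $a\ge0$, $\gamma_1,\gamma_2\in\mathbb{N}_0$ and $f\in C^2_{\gamma_1,\gamma_2}(I)$. Then for every $(x,y)\in I$, $$\lim_{n\to\infty}n\{K_{n,n}^a(f;x,y)-f(x,y)\}=\Big(-x+\frac{ax}{1+x}+\frac12\Big)f_x(x,y)+\Big(-y+\frac{ay}{1+y}+\frac12\Big)f_y(x,y)+\frac{x}{2}(x+1)f_{xx}(x,y)+\frac{y}{2}(y+1)f_{yy}(x,y).$$
   Context: $I=[0,\infty)\times[0,\infty)$, $\mathbb{N}=\{1,2,\dots\}$, $\mathbb{N}_0=\mathbb{N}\cup\{0\}$; $a\ge0$ is a fixed real parameter; functions are real-valued; subscripts on $f$ denote partial derivatives. Operators: let $(n)_0=1$, $(n)_i=n(n+1)\cdots(n+i-1)$ for $i\ge1$, $P_k(n,a)=\sum_{i=0}^{k}\binom{k}{i}(n)_i a^{k-i}$, and $$W_{n,k}^a(x)=e^{-\frac{ax}{1+x}}\frac{P_k(n,a)}{k!}\frac{x^k}{(1+x)^{n+k}},\qquad x\ge0,$$ (with $x^0=1$). Put $W^a_{n_1,n_2,k_1,k_2}(x,y)=W^a_{n_1,k_1}(x)W^a_{n_2,k_2}(y)$ and $$K_{n_1,n_2}^a(f;x,y)=(n_1+1)(n_2+1)\sum_{k_1=0}^\infty\sum_{k_2=0}^\infty W^a_{n_1,n_2,k_1,k_2}(x,y)\int_{\frac{k_2}{n_2+1}}^{\frac{k_2+1}{n_2+1}}\int_{\frac{k_1}{n_1+1}}^{\frac{k_1+1}{n_1+1}}f(u,v)\,du\,dv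 ;$$ $K_{n,n}^a$ is the case $n_1=n_2=n$. Weights and spaces: $\omega_\gamma(x)=(1+x^\gamma)^{-1}$ for $\gamma\in\mathbb{N}_0$ (with $x^0=1$), $\omega_{\gamma_1,\gamma_2}(x,y)=\omega_{\gamma_1}(x)\omega_{\gamma_2}(y)$. $C_{\gamma_1,\gamma_2}(I)$ is the set of $f\in C(I)$ such that $\omega_{\gamma_1,\gamma_2}f$ is bounded and uniformly continuous on $I$. For $m\in\mathbb{N}$, $C^m_{\gamma_1,\gamma_2}(I)$ is the space of $f\in C_{\gamma_1,\gamma_2}(I)$ whose partial derivatives $\frac{\partial^k f}{\partial x^s\partial y^{k-s}}$, $s=0,1,\dots,k$, $k=1,\dots,m$, belong to $C_{\gamma_1,\gamma_2}(I)$. *)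

(* Defs.v *)
From Stdlib Require Import Reals Factorial.
From Coquelicot Require Import Coquelicot.
Open Scope R_scope.

Definition quadrant (p : R * R) : Prop := 0 <= fst p /\ 0 <= snd p.

(** * Operators *)

(* [n (n + 1) ... (n + i - 1)] *)
Fixpoint rising (n i : nat) : nat :=
  match i with
  | O => 1%nat
  | S j => (rising n j * (n + j))%nat
  end.

(* [Binomial.C] is the binomial coefficient; unqualified, [C] is the type of
   complex numbers. *)
Definition P_coef (k n : nat) (a : R) : R :=
  sum_f_R0 (fun i => Binomial.C k i * INR (rising n i) * a ^ (k - i)) k.

Definition basis (a : R) (n k : nat) (x : R) : R :=
  exp (- (a * x / (1 + x))) * (P_coef k n a / INR (fact k)) *
  (x ^ k / (1 + x) ^ (n + k)).

Definition basis2 (a : R) (n1 n2 k1 k2 : nat) (x y : R) : R :=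
  basis a n1 k1 x * basis a n2 k2 y.

(* The inner integral is in the first variable, over the [k1]-th interval. *)
Definition kantorovich (a : R) (n1 n2 : nat) (f : R * R -> R) (x y : R) : R :=
  (INR n1 + 1) * (INR n2 + 1) *
  Series (fun k1 => Series (fun k2 =>
    basis2 a n1 n2 k1 k2 x y *
    RInt (fun v =>
      RInt (fun u => f (u, v))
        (INR k1 / (INR n1 + 1)) ((INR k1 + 1) / (INR n1 + 1)))
      (INR k2 / (INR n2 + 1)) ((INR k2 + 1) / (INR n2 + 1)))).

(** * Weighted spaces *)

Definition omega (g : nat) (x : R) : R := / (1 + x ^ g).

Definition omega2 (g1 g2 : nat) (p : R * R) : R :=
  omega g1 (fst p) * omega g2 (snd p).

Definition bounded_on {T : Type} (D : T -> Prop) (f : T -> R) : Prop :=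
  exists M : R, forall p, D p -> Rabs (f p) <= M.

Definition unif_continuous_on {T U : UniformSpace} (D : T -> Prop)
    (f : T -> U) : Prop :=
  forall eps : posreal, exists delta : posreal,
    forall p q, D p -> D q -> ball p delta q -> ball (f p) eps (f q).

(* A function on the quadrant is represented by a function on the plane; no
   notion below, at points of the quadrant, depends on its values outside. *)
Definition in_C (g1 g2 : nat) (f : R * R -> R) : Prop :=
  continuous_on quadrant f /\
  bounded_on quadrant (fun p => omega2 g1 g2 p * f p) /\
  unif_continuous_on quadrant (fun p => omega2 g1 g2 p * f p).

(** * Partial derivatives on the closed quadrant *)

(* [is_derive] with the neighbourhoods of [x] restricted to [D]: on the half
   line this is the usual derivative at [x > 0] and the right derivative
   at [0]. *)
Definition is_derive_on (D : R -> Prop) (f : R -> R) (x l : R) : Prop :=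
  filterdiff f (within D (locally x)) (fun h => scal h l).

Definition ex_derive_on (D : R -> Prop) (f : R -> R) (x : R) : Prop :=
  exists l, is_derive_on D f x l.

(* The derivative where it exists, an unspecified real elsewhere. *)
Definition Derive_on (D : R -> Prop) (f : R -> R) (x : R) : R :=
  iota (fun l => is_derive_on D f x l).

Definition half_line (x : R) : Prop := 0 <= x.

Definition ex_partial_x (f : R * R -> R) (p : R * R) : Prop :=
  ex_derive_on half_line (fun u => f (u, snd p)) (fst p).

Definition ex_partial_y (f : R * R -> R) (p : R * R) : Prop :=
  ex_derive_on half_line (fun v => f (fst p, v)) (snd p).

Definition partial_x (f : R * R -> R) (p : R * R) : R :=
  Derive_on half_line (fun u => f (u, snd p)) (fst p).

Definition partial_y (f : R * R -> R) (p : R * R) : R :=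
  Derive_on half_line (fun v => f (fst p, v)) (snd p).

(* The derivative of order [s + t], first [t] times in the second variable,
   then [s] times in the first one. *)
Definition partial (s t : nat) (f : R * R -> R) : R * R -> R :=
  Nat.iter s partial_x (Nat.iter t partial_y f).

(* Each of the successive differentiations defining [partial s t f] is
   possible on the whole quadrant. *)
Definition ex_partial (s t : nat) (f : R * R -> R) : Prop :=
  (forall j p, (j < t)%nat -> quadrant p -> ex_partial_y (partial 0 j f) p) /\
  (forall i p, (i < s)%nat -> quadrant p -> ex_partial_x (partial i t f) p).

Definition in_Cm (m g1 g2 : nat) (f : R * R -> R) : Prop :=
  in_C g1 g2 f /\
  forall k s, (1 <= k <= m)%nat -> (s <= k)%nat ->
    ex_partial s (k - s) f /\ in_C g1 g2 (partial s (k - s) f).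

(* Main.v *)
Require Import Defs.
From Stdlib Require Import Reals Factorial Lra Lia.
From Coquelicot Require Import Coquelicot.
Open Scope R_scope.

(** The operator is positive, so it is enough to enclose [f] between two
    functions whose images are known up to [o(1 / n)].  The enclosing functions
    are polynomials in [w = exp (u - x) - 1] and [z = exp (v - y) - 1] rather
    than in [u - x] and [v - y].  Two facts make this choice convenient.

    First, the image of an exponential is explicit.  The coefficients
    [P_coef k n a / k!] are those of the Cauchy product of [exp (a s)] with the
    negative binomial series [(1 - s)^(-n)] ([is_series_P_coef]), so the mean of
    [th^k] against the basis is a closed expression in [th]
    ([is_series_basis_pow]), and averaging [exp (s (u - x))] over cells gives
    [exp_mean].  A second order expansion of its logarithm in [h = s / (n + 1)]
    shows that [n (exp_mean - 1)] tends to
    [s drift + s^2 diffusion / 2] ([exp_mean_asymptotics]), where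
    [drift = - x + a x / (1 + x) + 1 / 2] and [diffusion = x (x + 1)].  By
    linearity, [n] times the means of [w], [w^2] and [w^4] tend to
    [drift + diffusion / 2], [diffusion] and [0] ([quartic_mean]).

    Second, the functions [1 + w^2] and [1 + z^2] control every polynomial
    weight.  If [T] is the quadratic polynomial in [w] and [z] with the same
    2-jet as [f] at [(x, y)], then for every [eps > 0] there is [M] such that
    [|f - T| <= eps (w^2 + z^2) + M (w^4 + z^4)] on the whole quadrant
    ([quadratic_expansion]): near [(x, y)] by continuity of the second
    derivatives, elsewhere because [w^2 + z^2] is bounded below there and
    [f - T] grows at most like [1 + w^2 + z^2].

    The bounds [T - error] and [T + error] are sums of a function of [u], a
    function of [v] and a multiple of [w z], so applying the operator to them
    only involves univariate means ([kantorovich_bounds]).  After multiplication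
    by [n], the terms in [w^4], [z^4] and [w z] disappear, and [eps] is
    arbitrary. *)

(** * The generating function of the basis *)

Lemma is_series_value (u : nat -> R) (s t : R) :
  is_series u s -> s = t -> is_series u t.
Proof. now intros H <-. Qed.

Lemma is_series_eq (u v : nat -> R) (s t : R) :
  is_series u s -> (forall k, v k = u k) -> s = t -> is_series v t.
Proof. intros H E <-. now apply is_series_ext with u. Qed.

Lemma rising_S (n i : nat) : rising n (S i) = (n * rising (S n) i)%nat.
Proof.
  induction i as [|i IH]; [simpl; lia|].
  change (rising n (S (S i))) with (rising n (S i) * (n + S i))%nat.
  rewrite IH. simpl. lia.
Qed.

(** The hockey-stick identity, which says that multiplication by the geometric
    series turns the negative binomial series of exponent [n] into the one of
    exponent [n + 1]. *)
Lemma sum_rising (n i : nat) :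
  sum_f_R0 (fun j => INR (rising n j) / INR (fact j)) i
  = INR (rising (S n) i) / INR (fact i).
Proof.
  induction i as [|i IH]; [reflexivity|].
  rewrite tech5, IH, rising_S, fact_simpl.
  change (rising (S n) (S i)) with (rising (S n) i * (S n + i))%nat.
  replace (S n + i)%nat with (n + S i)%nat by lia.
  rewrite !mult_INR, plus_INR.
  pose proof (INR_fact_neq_0 i).
  assert (INR (S i) <> 0) by now apply not_0_INR.
  field. tauto.
Qed.

Lemma is_series_negative_binomial (n : nat) (s : R) : 0 <= s < 1 ->
  is_series (fun i => INR (rising n i) / INR (fact i) * s ^ i) (/ (1 - s) ^ n).
Proof.
  intros Hs. induction n as [|n IH].
  - apply is_series_value with 1; [|simpl; field].
    apply filterlim_ext with (fun _ => 1); [|apply filterlim_const].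
    intros k. induction k as [|k IHk].
    + rewrite sum_O. simpl. field.
    + rewrite sum_Sn, <- IHk, rising_S, Nat.mul_0_l. unfold plus; simpl.
      unfold Rdiv. ring.
  - assert (Hp : forall i, 0 <= s ^ i) by (intros; apply pow_le; lra).
    assert (G : is_series (fun i => s ^ i) (/ (1 - s)))
      by (apply is_series_geom; rewrite Rabs_pos_eq; lra).
    apply is_series_value with (/ (1 - s) ^ n * / (1 - s));
      [|simpl; field; split; [apply pow_nonzero|]; lra].
    eapply is_series_ext; [|apply (is_series_mult_pos _ _ _ _ IH G)].
    + intros i; simpl. rewrite <- sum_rising, (Rmult_comm _ (s ^ i)), scal_sum.
      apply sum_eq. intros j Hj.
      replace (s ^ i) with (s ^ j * s ^ (i - j))
        by (rewrite <- pow_add; f_equal; lia). ring.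
    + intros i. apply Rmult_le_pos; [|apply Hp].
      apply Rdiv_le_0_compat; [apply pos_INR|apply INR_fact_lt_0].
    + exact Hp.
Qed.

Lemma is_series_exp (z : R) :
  is_series (fun k => z ^ k / INR (fact k)) (exp z).
Proof.
  eapply is_series_ext; [|apply is_exp_Reals].
  intros k. rewrite pow_n_pow. reflexivity.
Qed.

(** Up to the factor [k!], the coefficient [P_coef k n a] is the [k]-th term of
    the Cauchy product of the negative binomial series with the exponential. *)
Lemma is_series_P_coef (a s : R) (n : nat) : 0 <= a -> 0 <= s < 1 ->
  is_series (fun k => P_coef k n a / INR (fact k) * s ^ k)
    (exp (a * s) / (1 - s) ^ n).
Proof.
  intros Ha Hs.
  apply is_series_value with (/ (1 - s) ^ n * exp (a * s)); [|apply Rmult_comm].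
  eapply is_series_ext;
    [|apply (is_series_mult_pos _ _ _ _ (is_series_negative_binomial n s Hs)
        (is_series_exp (a * s)))].
  - intros k. symmetry. unfold P_coef, Rdiv.
    rewrite Rmult_assoc, (Rmult_comm (sum_f_R0 _ _)), scal_sum.
    apply sum_eq. intros i Hi. unfold Binomial.C, Rdiv. rewrite Rpow_mult_distr.
    replace (s ^ k) with (s ^ i * s ^ (k - i))
      by (rewrite <- pow_add; f_equal; lia).
    field. repeat split; apply INR_fact_neq_0.
  - intros i. apply Rmult_le_pos; [|apply pow_le; lra].
    apply Rdiv_le_0_compat; [apply pos_INR|apply INR_fact_lt_0].
  - intros i. apply Rdiv_le_0_compat; [|apply INR_fact_lt_0].
    apply pow_le, Rmult_le_pos; lra.
Qed.

Lemma basis_nonneg (a x : R) (n k : nat) : 0 <= a -> 0 <= x ->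
  0 <= basis a n k x.
Proof.
  intros Ha Hx. unfold basis.
  assert (Hf : forall i, 0 < INR (fact i)) by (intros; apply INR_fact_lt_0).
  repeat apply Rmult_le_pos.
  - apply Rlt_le, exp_pos.
  - apply cond_pos_sum. intros i. unfold Binomial.C.
    repeat apply Rmult_le_pos; [| |apply pos_INR|now apply pow_le].
    + apply pos_INR.
    + apply Rlt_le, Rinv_0_lt_compat, Rmult_lt_0_compat; apply Hf.
  - apply Rlt_le, Rinv_0_lt_compat, Hf.
  - now apply pow_le.
  - apply Rlt_le, Rinv_0_lt_compat, pow_lt. lra.
Qed.

(** With [t = x / (1 + x)] this is the quotient of the values at [t * th] and at
    [t] of the sum in [is_series_P_coef], because
    [1 - t * th = (1 - t) * (1 - x * (th - 1))]. *)
Lemma is_series_basis_pow (a x th : R) (n : nat) :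
  0 <= a -> 0 <= x -> 0 <= th -> x * (th - 1) < 1 ->
  is_series (fun k => basis a n k x * th ^ k)
    (exp (a * (x / (1 + x)) * (th - 1)) / (1 - x * (th - 1)) ^ n).
Proof.
  intros Ha Hx Hth Hlt.
  assert (Hs : 0 <= x / (1 + x) * th < 1).
  { split; [apply Rmult_le_pos; [apply Rdiv_le_0_compat|]; lra|].
    apply Rmult_lt_reg_r with (1 + x); [lra|].
    replace (x / (1 + x) * th * (1 + x)) with (x * th) by (field; lra). lra. }
  assert (Hn : (1 + x) ^ n <> 0) by (apply pow_nonzero; lra).
  pose proof (is_series_scal_l (exp (- (a * x / (1 + x))) / (1 + x) ^ n) _ _
    (is_series_P_coef a _ n Ha Hs)) as H.
  eapply is_series_eq; [exact H| |].
  - intros k. unfold basis, scal; simpl; unfold mult; simpl.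
    unfold Rdiv. rewrite !Rpow_mult_distr, pow_inv, pow_add.
    field. repeat split; try apply INR_fact_neq_0; apply pow_nonzero; lra.
  - unfold scal; simpl; unfold mult; simpl.
    replace (1 - x / (1 + x) * th) with ((1 - x * (th - 1)) * / (1 + x))
      by (field; lra).
    rewrite Rpow_mult_distr, pow_inv.
    replace (a * (x / (1 + x)) * (th - 1))
      with (- (a * x / (1 + x)) + a * (x / (1 + x) * th)) by (field; lra).
    rewrite exp_plus. field. split; [apply pow_nonzero; lra|exact Hn].
Qed.

(** * Means over cells *)

Definition cell_avg (n : nat) (g : R -> R) (k : nat) : R :=
  (INR n + 1) * RInt g (INR k / (INR n + 1)) ((INR k + 1) / (INR n + 1)).

(** The value [m] of the univariate operator at [g]; it is a relation because
    the series of an exponential converges for large [n] only.  Continuity of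
    [g] makes the relation linear in [g]. *)
Definition is_mean (a : R) (n : nat) (x : R) (g : R -> R) (m : R) : Prop :=
  (forall u, continuous g u) /\
  is_series (fun k => basis a n k x * cell_avg n g k) m.

Lemma INR_succ_pos (n : nat) : 0 < INR n + 1.
Proof. pose proof (pos_INR n). lra. Qed.

Lemma ex_RInt_everywhere_continuous (g : R -> R) (c d : R) :
  (forall u, continuous g u) -> ex_RInt g c d.
Proof. intros H. apply (@ex_RInt_continuous R_CompleteNormedModule). auto. Qed.

Lemma is_RInt_everywhere_continuous (g : R -> R) (c d : R) :
  (forall u, continuous g u) -> is_RInt g c d (RInt g c d).
Proof.
  intros H. apply (@RInt_correct R_CompleteNormedModule).
  now apply ex_RInt_everywhere_continuous.
Qed.

Lemma cell_avg_plus (n k : nat) (g h : R -> R) :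
  (forall u, continuous g u) -> (forall u, continuous h u) ->
  cell_avg n (fun u => g u + h u) k = cell_avg n g k + cell_avg n h k.
Proof.
  intros Hg Hh. unfold cell_avg. rewrite <- Rmult_plus_distr_l. f_equal.
  apply (RInt_plus g h); now apply ex_RInt_everywhere_continuous.
Qed.

Lemma cell_avg_scal (n k : nat) (c : R) (g : R -> R) :
  (forall u, continuous g u) ->
  cell_avg n (fun u => c * g u) k = c * cell_avg n g k.
Proof.
  intros Hg. unfold cell_avg. rewrite (Rmult_comm c), Rmult_assoc. f_equal.
  rewrite Rmult_comm.
  apply (RInt_scal g); now apply ex_RInt_everywhere_continuous.
Qed.

Lemma cell_avg_const (n k : nat) (c : R) : cell_avg n (fun _ => c) k = c.
Proof.
  unfold cell_avg. rewrite RInt_const. unfold scal; simpl; unfold mult; simpl.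
  pose proof (INR_succ_pos n). field. lra.
Qed.

Lemma is_mean_ext (a : R) (n : nat) (x : R) (g h : R -> R) (m : R) :
  (forall u, g u = h u) -> is_mean a n x g m -> is_mean a n x h m.
Proof.
  intros E [C S]. split.
  - intros u. apply continuous_ext with g; auto.
  - eapply is_series_ext; [|exact S]. intros k. unfold cell_avg.
    do 2 f_equal. apply RInt_ext. auto.
Qed.

Lemma is_mean_plus (a : R) (n : nat) (x : R) (g h : R -> R) (l m : R) :
  is_mean a n x g l -> is_mean a n x h m ->
  is_mean a n x (fun u => g u + h u) (l + m).
Proof.
  intros [Cg Sg] [Ch Sh]. split.
  - intros u. now apply (continuous_plus g h).
  - eapply is_series_eq; [exact (is_series_plus _ _ _ _ Sg Sh)| |reflexivity].
    intros k. rewrite cell_avg_plus by assumption. unfold plus; simpl. ring.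
Qed.

Lemma is_mean_scal (a : R) (n : nat) (x c : R) (g : R -> R) (l : R) :
  is_mean a n x g l -> is_mean a n x (fun u => c * g u) (c * l).
Proof.
  intros [Cg Sg]. split.
  - intros u. now apply (continuous_scal_r c g).
  - eapply is_series_eq; [exact (is_series_scal_l c _ _ Sg)| |reflexivity].
    intros k. rewrite cell_avg_scal by assumption.
    unfold scal; simpl; unfold mult; simpl. ring.
Qed.

Lemma is_series_basis (a x : R) (n : nat) : 0 <= a -> 0 <= x ->
  is_series (fun k => basis a n k x) 1.
Proof.
  intros Ha Hx.
  eapply is_series_eq; [apply (is_series_basis_pow a x 1 n); lra| |].
  - intros k. simpl. rewrite pow1. ring.
  - rewrite Rminus_diag, !Rmult_0_r, exp_0, Rminus_0_r, pow1. field.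
Qed.

Lemma is_mean_const (a x c : R) (n : nat) : 0 <= a -> 0 <= x ->
  is_mean a n x (fun _ => c) c.
Proof.
  intros Ha Hx. split; [intros u; apply continuous_const|].
  eapply is_series_eq;
    [apply (is_series_scal_l c _ _ (is_series_basis a x n Ha Hx))| |].
  - intros k. rewrite cell_avg_const. apply Rmult_comm.
  - apply Rmult_1_r.
Qed.

Lemma exp_INR_mult (k : nat) (h : R) : exp (INR k * h) = exp h ^ k.
Proof.
  induction k as [|k IH]; [now rewrite Rmult_0_l, exp_0|].
  rewrite S_INR, Rmult_plus_distr_r, Rmult_1_l, exp_plus, IH. simpl. ring.
Qed.

(** The value of the univariate operator at [u |-> exp (s * (u - x))]. *)
Definition exp_mean (a x s : R) (n : nat) : R :=
  let g := exp (s / (INR n + 1)) - 1 in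
  g / (s / (INR n + 1)) *
  (exp (a * (x / (1 + x)) * g) / (1 - x * g) ^ n * exp (- (s * x))).

Lemma cell_avg_exp (n k : nat) (s x : R) : s <> 0 ->
  cell_avg n (fun u => exp (s * (u - x))) k
  = (exp (s / (INR n + 1)) - 1) / (s / (INR n + 1)) * exp (- (s * x))
    * exp (s / (INR n + 1)) ^ k.
Proof.
  intros Hs. unfold cell_avg. pose proof (INR_succ_pos n).
  erewrite is_RInt_unique; [|apply (is_RInt_derive (fun u => exp (s * (u - x)) / s))].
  - unfold minus, plus, opp; simpl.
    replace (s * ((INR k + 1) / (INR n + 1) - x))
      with (INR k * (s / (INR n + 1)) + s / (INR n + 1) + - (s * x)) by (field; lra).
    replace (s * (INR k / (INR n + 1) - x))
      with (INR k * (s / (INR n + 1)) + - (s * x)) by (field; lra).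
    rewrite !exp_plus, exp_INR_mult. field. lra.
  - intros u _. auto_derive; [trivial|].
    unfold Rminus. field. exact Hs.
  - intros u _. apply (ex_derive_continuous (fun u => exp (s * (u - x)))).
    auto_derive. trivial.
Qed.

Lemma is_mean_exp (a x s : R) (n : nat) : 0 <= a -> 0 <= x -> s <> 0 ->
  x * (exp (s / (INR n + 1)) - 1) < 1 ->
  is_mean a n x (fun u => exp (s * (u - x))) (exp_mean a x s n).
Proof.
  intros Ha Hx Hs Hlt. split.
  - intros u. apply (ex_derive_continuous (fun u => exp (s * (u - x)))).
    auto_derive. trivial.
  - eapply is_series_eq;
      [apply (is_series_scal_l ((exp (s / (INR n + 1)) - 1) / (s / (INR n + 1))
          * exp (- (s * x))) _ _
          (is_series_basis_pow a x (exp (s / (INR n + 1))) n Ha Hx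
            (Rlt_le _ _ (exp_pos _)) Hlt))| |].
    + intros k. rewrite cell_avg_exp by exact Hs.
      unfold scal; simpl; unfold mult; simpl. ring.
    + unfold exp_mean, scal; simpl; unfold mult; simpl. ring.
Qed.

(** * Expansions along sequences of order [1 / n] *)

Lemma is_lim_seq_0_of_bounds (u : nat -> R) :
  (forall eps, 0 < eps -> eventually (fun n => Rabs (u n) <= eps)) ->
  is_lim_seq u 0.
Proof.
  intros H. apply is_lim_seq_spec. intros eps.
  assert (He : 0 < eps / 2) by (apply is_pos_div_2).
  generalize (H _ He). apply filter_imp. intros n Hn.
  rewrite Rminus_0_r. pose proof (cond_pos eps). lra.
Qed.

Lemma is_lim_seq_inv_succ : is_lim_seq (fun n => / (INR n + 1)) 0.
Proof.
  apply is_lim_seq_ext with (fun n => / INR (S n)).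
  - intros n. now rewrite S_INR.
  - apply (is_lim_seq_incr_1 (fun n => / INR n)).
    replace (Finite 0) with (Rbar_inv p_infty) by reflexivity.
    apply is_lim_seq_inv; [apply is_lim_seq_INR|discriminate].
Qed.

Lemma is_lim_seq_ratio_succ : is_lim_seq (fun n => INR n / (INR n + 1)) 1.
Proof.
  apply is_lim_seq_ext with (fun n => 1 - / (INR n + 1)).
  - intros n. pose proof (INR_succ_pos n). field. lra.
  - replace (Finite 1) with (Finite (1 - 0)) by (f_equal; ring).
    apply is_lim_seq_minus'; [apply is_lim_seq_const|apply is_lim_seq_inv_succ].
Qed.

Lemma is_lim_seq_value (u : nat -> R) (l m : R) :
  is_lim_seq u l -> l = m -> is_lim_seq u m.
Proof. now intros H <-. Qed.

Lemma is_lim_seq_step (s : R) : is_lim_seq (fun n => s / (INR n + 1)) 0.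
Proof.
  apply is_lim_seq_value with (s * 0); [|ring].
  apply is_lim_seq_mult'; [apply is_lim_seq_const|apply is_lim_seq_inv_succ].
Qed.

Lemma is_lim_seq_0_of_rescaled (e : nat -> R) (l : R) :
  is_lim_seq (fun n => INR n * e n) l -> is_lim_seq e 0.
Proof.
  intros H. apply is_lim_seq_ext_loc with (fun n => / INR n * (INR n * e n)).
  - exists 1%nat. intros n Hn.
    assert (INR n <> 0) by (apply not_0_INR; lia). now field.
  - apply is_lim_seq_value with (0 * l); [|ring].
    apply is_lim_seq_mult'; [|exact H].
    replace (Finite 0) with (Rbar_inv p_infty) by reflexivity.
    apply is_lim_seq_inv; [apply is_lim_seq_INR|discriminate].
Qed.

Lemma first_order_along (F : R -> R) (d l : R) (e : nat -> R) :
  is_derive F 0 d -> is_lim_seq (fun n => INR n * e n) l ->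
  is_lim_seq (fun n => INR n * (F (e n) - F 0)) (d * l).
Proof.
  intros [_ HF] He.
  pose proof (is_lim_seq_0_of_rescaled _ _ He) as He0.
  apply is_lim_seq_ext with
    (fun n => d * (INR n * e n) + INR n * (F (e n) - F 0 - d * e n));
    [intros n; ring|].
  apply is_lim_seq_value with (d * l + 0); [|ring].
  apply is_lim_seq_plus';
    [apply is_lim_seq_mult'; [apply is_lim_seq_const|exact He]|].
  apply is_lim_seq_0_of_bounds. intros eps Heps.
  assert (Hl : 0 < Rabs l + 1) by (pose proof (Rabs_pos l); lra).
  assert (Hb : eventually (fun n => Rabs (INR n * e n) <= Rabs l + 1)).
  { apply is_lim_seq_spec in He. generalize (He (mkposreal 1 Rlt_0_1)).
    apply filter_imp. simpl. intros n Hn.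
    pose proof (Rabs_triang_inv (INR n * e n) l). lra. }
  assert (Hd : 0 < eps / (Rabs l + 1)) by now apply Rdiv_lt_0_compat.
  
  pose proof (He0 _ (HF 0 (fun P HP => HP) (mkposreal _ Hd))) as Hr.
  generalize (filter_and _ _ Hb Hr).
  apply filter_imp. simpl. intros n [H1 H2].
  unfold norm, minus, plus, opp, scal in H2; simpl in H2.
  unfold abs, mult in H2; simpl in H2.
  replace (F (e n) + - F 0 + - ((e n + - 0) * d))
    with (F (e n) - F 0 - d * e n) in H2 by ring.
  replace (e n + - 0) with (e n) in H2 by ring.
  rewrite Rabs_mult, (Rabs_pos_eq (INR n)) by apply pos_INR.
  rewrite Rabs_mult, (Rabs_pos_eq (INR n)) in H1 by apply pos_INR.
  apply Rle_trans with (INR n * (eps / (Rabs l + 1) * Rabs (e n))).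
  - apply Rmult_le_compat_l; [apply pos_INR|exact H2].
  - replace (INR n * (eps / (Rabs l + 1) * Rabs (e n)))
      with (eps / (Rabs l + 1) * (INR n * Rabs (e n))) by ring.
    apply Rle_trans with (eps / (Rabs l + 1) * (Rabs l + 1)).
    + apply Rmult_le_compat_l; lra.
    + right. field. lra.
Qed.

(** The mean value theorem, applied to
    [t |-> F t - F1 0 * t - F2 0 * t^2 / 2] and then to
    [t |-> F1 t - F2 0 * t]. *)
Lemma second_order_remainder (F F1 F2 : R -> R) (d eps h : R) :
  (forall t, Rabs t < d -> is_derive F t (F1 t)) ->
  (forall t, Rabs t < d -> is_derive F1 t (F2 t)) ->
  (forall t, Rabs t < d -> Rabs (F2 t - F2 0) <= eps) ->
  Rabs h < d ->
  Rabs (F h - F 0 - F1 0 * h - F2 0 * h ^ 2 / 2) <= eps * h ^ 2.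
Proof.
  intros H1 H2 H3 Hh.
  assert (Hin : forall b t, Rabs b < d -> Rmin 0 b <= t <= Rmax 0 b ->
    Rabs t < d /\ Rabs t <= Rabs b).
  { intros b t Hb. unfold Rmin, Rmax. destruct (Rle_dec 0 b);
      unfold Rabs in *; destruct (Rcase_abs b), (Rcase_abs t); lra. }
  destruct (MVT_gen (fun t => F t - F1 0 * t - F2 0 * t ^ 2 / 2) 0 h
    (fun t => F1 t - F1 0 - F2 0 * t)) as [xi [Hxi E1]].
  { intros t Ht. destruct (Hin h t Hh) as [Ht' _]; [lra|].
    auto_derive; [exists (F1 t); auto|].
    replace (Derive (fun u : R => F u) t) with (F1 t)
      by (symmetry; now apply is_derive_unique, H1). field. }
  { intros t Ht. destruct (Hin h t Hh Ht) as [Ht' _].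
    apply derivable_continuous_pt, ex_derive_Reals_0.
    auto_derive. exists (F1 t); auto. }
  destruct (Hin h xi Hh Hxi) as [Hxi1 Hxi2].
  destruct (MVT_gen (fun t => F1 t - F2 0 * t) 0 xi
    (fun t => F2 t - F2 0)) as [zeta [Hz E2]].
  { intros t Ht. destruct (Hin xi t Hxi1) as [Ht' _]; [lra|].
    auto_derive; [exists (F2 t); auto|].
    replace (Derive (fun u : R => F1 u) t) with (F2 t)
      by (symmetry; now apply is_derive_unique, H2). field. }
  { intros t Ht. destruct (Hin xi t Hxi1 Ht) as [Ht' _].
    apply derivable_continuous_pt, ex_derive_Reals_0.
    auto_derive. exists (F2 t); auto. }
  destruct (Hin xi zeta Hxi1 Hz) as [Hz1 _].
  replace (F h - F 0 - F1 0 * h - F2 0 * h ^ 2 / 2)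
    with ((F2 zeta - F2 0) * xi * h).
  2: { transitivity ((F1 xi - F1 0 - F2 0 * xi) * h).
       - f_equal. rewrite Rminus_0_r in E2. rewrite <- E2. ring.
       - rewrite Rminus_0_r in E1. rewrite <- E1. field. }
  rewrite !Rabs_mult.
  replace (h ^ 2) with (Rabs h * Rabs h) by (rewrite <- pow2_abs; ring).
  rewrite <- Rmult_assoc. apply Rmult_le_compat_r; [apply Rabs_pos|].
  apply Rmult_le_compat; auto using Rabs_pos.
Qed.

Lemma second_order_along (F F1 F2 : R -> R) (s : R) :
  locally 0 (fun t => is_derive F t (F1 t)) ->
  locally 0 (fun t => is_derive F1 t (F2 t)) ->
  continuous F2 0 ->
  is_lim_seq (fun n => (INR n + 1) ^ 2 *
    (F (s / (INR n + 1)) - F 0 - F1 0 * (s / (INR n + 1)))) (F2 0 * s ^ 2 / 2).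
Proof.
  intros H1 H2 H3.
  pose proof (is_lim_seq_step s) as Hh.
  apply is_lim_seq_ext with (fun n => F2 0 * s ^ 2 / 2 + (INR n + 1) ^ 2 *
    (F (s / (INR n + 1)) - F 0 - F1 0 * (s / (INR n + 1))
     - F2 0 * (s / (INR n + 1)) ^ 2 / 2)).
  { intros n. pose proof (INR_succ_pos n). field. lra. }
  apply is_lim_seq_value with (F2 0 * s ^ 2 / 2 + 0); [|ring].
  apply is_lim_seq_plus'; [apply is_lim_seq_const|].
  apply is_lim_seq_0_of_bounds. intros eps Heps.
  assert (Hs : 0 < s ^ 2 + 1) by (pose proof (pow2_ge_0 s); lra).
  assert (He : 0 < eps / (s ^ 2 + 1)) by now apply Rdiv_lt_0_compat.
  pose proof (proj1 (filterlim_locally F2 (F2 0)) H3) as H3'. clear H3. rename H3' into H3.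
  destruct (filter_and _ _ (filter_and _ _ H1 H2) (H3 (mkposreal _ He)))
    as [d Hd].
  assert (Hd' : forall t, Rabs t < d -> ball 0 d t).
  { intros t Ht. unfold ball; simpl. unfold AbsRing_ball, abs, minus, plus, opp; simpl.
    now rewrite Ropp_0, Rplus_0_r. }
  apply is_lim_seq_spec in Hh.
  generalize (Hh d). apply filter_imp. intros n Hn. rewrite Rminus_0_r in Hn.
  pose proof (second_order_remainder F F1 F2 d (eps / (s ^ 2 + 1)) _
    (fun t Ht => proj1 (proj1 (Hd t (Hd' t Ht))))
    (fun t Ht => proj2 (proj1 (Hd t (Hd' t Ht))))
    (fun t Ht => Rlt_le _ _ (proj2 (Hd t (Hd' t Ht)))) Hn) as B.
  pose proof (INR_succ_pos n) as HN.
  rewrite Rabs_mult, (Rabs_pos_eq ((INR n + 1) ^ 2)) by apply pow2_ge_0.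
  apply Rle_trans with
    ((INR n + 1) ^ 2 * (eps / (s ^ 2 + 1) * (s / (INR n + 1)) ^ 2)).
  - apply Rmult_le_compat_l; [apply pow2_ge_0|exact B].
  - replace ((INR n + 1) ^ 2 * (eps / (s ^ 2 + 1) * (s / (INR n + 1)) ^ 2))
      with (eps * (s ^ 2 / (s ^ 2 + 1))) by (field; lra).
    rewrite <- (Rmult_1_r eps) at 2. apply Rmult_le_compat_l; [lra|].
    apply Rmult_le_reg_r with (s ^ 2 + 1); [lra|].
    unfold Rdiv. rewrite Rmult_assoc, Rinv_l; lra.
Qed.

(** * Asymptotics of the exponential moments *)

Lemma is_lim_seq_rescaled_step (s : R) :
  is_lim_seq (fun n => INR n * (s / (INR n + 1))) s.
Proof.
  apply is_lim_seq_ext with (fun n => s * (INR n / (INR n + 1))).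
  - intros n. unfold Rdiv. ring.
  - apply is_lim_seq_value with (s * 1); [|ring].
    apply is_lim_seq_mult'; [apply is_lim_seq_const|apply is_lim_seq_ratio_succ].
Qed.

(** Positivity of this expression is the condition for the convergence of the
    series in [is_series_basis_pow] at [th = exp h]. *)
Lemma locally_log_domain (x : R) : locally 0 (fun h => 0 < 1 - x * (exp h - 1)).
Proof.
  apply (continuous_comp (fun h => 1 - x * (exp h - 1)) (fun y => y) 0).
  - apply (ex_derive_continuous (fun h => 1 - x * (exp h - 1))).
    auto_derive. trivial.
  - apply continuous_id.
  - rewrite exp_0, Rminus_diag, Rmult_0_r, Rminus_0_r. apply (open_gt 0). lra.
Qed.

Lemma eventually_log_domain (x s : R) :
  eventually (fun n => x * (exp (s / (INR n + 1)) - 1) < 1).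
Proof.
  apply (filter_imp (fun n => 0 < 1 - x * (exp (s / (INR n + 1)) - 1))).
  - intros n Hn. lra.
  - exact (is_lim_seq_step s _ (locally_log_domain x)).
Qed.

Lemma exp_minus_1_ratio_along (s : R) : s <> 0 ->
  is_lim_seq (fun n => INR n *
    ((exp (s / (INR n + 1)) - 1) / (s / (INR n + 1)) - 1)) (s / 2).
Proof.
  intros Hs.
  apply is_lim_seq_ext with (fun n => INR n / (INR n + 1) * (/ s *
    ((INR n + 1) ^ 2 *
     (exp (s / (INR n + 1)) - exp 0 - exp 0 * (s / (INR n + 1)))))).
  { intros n. rewrite exp_0. pose proof (INR_succ_pos n). field. lra. }
  apply is_lim_seq_value with (1 * (/ s * (exp 0 * s ^ 2 / 2)));
    [|rewrite exp_0; now field].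
  apply is_lim_seq_mult'; [apply is_lim_seq_ratio_succ|].
  apply is_lim_seq_mult'; [apply is_lim_seq_const|].
  apply second_order_along.
  - apply filter_forall. apply is_derive_exp.
  - apply filter_forall. apply is_derive_exp.
  - apply (ex_derive_continuous exp 0). exists (exp 0). apply is_derive_exp.
Qed.

Lemma log_factor_along (x s : R) :
  is_lim_seq (fun n => INR n *
    (INR n * - ln (1 - x * (exp (s / (INR n + 1)) - 1)) - s * x))
    ((x + x ^ 2) * s ^ 2 / 2 - s * x).
Proof.
  set (F := fun h => - ln (1 - x * (exp h - 1))).
  set (F1 := fun h => x * exp h / (1 - x * (exp h - 1))).
  set (F2 := fun h => F1 h + F1 h ^ 2).
  assert (HF0 : F 0 = 0).
  { unfold F. rewrite exp_0, Rminus_diag, Rmult_0_r, Rminus_0_r, ln_1. ring. }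
  assert (HF1 : F1 0 = x).
  { unfold F1. rewrite exp_0, Rminus_diag, Rmult_0_r, Rminus_0_r. field. }
  assert (H : is_lim_seq (fun n => (INR n + 1) ^ 2 *
    (F (s / (INR n + 1)) - F 0 - F1 0 * (s / (INR n + 1)))) (F2 0 * s ^ 2 / 2)).
  { apply second_order_along.
    - generalize (locally_log_domain x). apply filter_imp. intros h Hh.
      unfold F, F1. auto_derive; [exact Hh|]. unfold Rminus in Hh |- *. field. lra.
    - generalize (locally_log_domain x). apply filter_imp. intros h Hh.
      unfold F2, F1. auto_derive; [lra|]. unfold Rminus in Hh |- *. field. lra.
    - unfold F2, F1.
      apply (ex_derive_continuous (fun h => x * exp h / (1 - x * (exp h - 1)) +
        (x * exp h / (1 - x * (exp h - 1))) ^ 2)).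
      auto_derive. rewrite exp_0. lra. }
  apply is_lim_seq_ext with (fun n => INR n / (INR n + 1) *
    (INR n / (INR n + 1) * ((INR n + 1) ^ 2 *
      (F (s / (INR n + 1)) - F 0 - F1 0 * (s / (INR n + 1)))) - s * x)).
  { intros n. rewrite HF0, HF1. pose proof (INR_succ_pos n).
    unfold F. field. lra. }
  apply is_lim_seq_value with (1 * (1 * (F2 0 * s ^ 2 / 2) - s * x)).
  2: { unfold F2. rewrite HF1. field. }
  apply is_lim_seq_mult'; [apply is_lim_seq_ratio_succ|].
  apply is_lim_seq_minus'; [|apply is_lim_seq_const].
  apply is_lim_seq_mult'; [apply is_lim_seq_ratio_succ|exact H].
Qed.

(** The coefficients of the first and of (one half) the second derivative in the
    limit operator. *)
Definition drift (a x : R) : R := - x + a * x / (1 + x) + 1 / 2.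
Definition diffusion (x : R) : R := x * (x + 1).

(** The exponential moment is the average of [exp] over a cell times the
    exponential of
    [a x / (1 + x) (e^h - 1) - n ln (1 - x (e^h - 1)) - s x], [h = s / (n + 1)];
    the three terms of the limit other than the diffusion are the contributions
    of that average, of the parameter [a], and of [n h - s]. *)
Lemma exp_mean_asymptotics (a x s : R) : 0 <= x -> s <> 0 ->
  is_lim_seq (fun n => INR n * (exp_mean a x s n - 1))
    (s * drift a x + s ^ 2 * diffusion x / 2).
Proof.
  intros Hx Hs.
  set (q := fun n => (exp (s / (INR n + 1)) - 1) / (s / (INR n + 1))).
  set (e := fun n => a * (x / (1 + x)) * (exp (s / (INR n + 1)) - 1)
    + (INR n * - ln (1 - x * (exp (s / (INR n + 1)) - 1)) - s * x)).
  assert (He : is_lim_seq (fun n => INR n * e n)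
    (a * (x / (1 + x)) * s + ((x + x ^ 2) * s ^ 2 / 2 - s * x))).
  { apply is_lim_seq_ext with (fun n =>
      a * (x / (1 + x)) * (INR n * (exp (s / (INR n + 1)) - exp 0))
      + INR n * (INR n * - ln (1 - x * (exp (s / (INR n + 1)) - 1)) - s * x)).
    { intros n. rewrite exp_0. unfold e. ring. }
    apply is_lim_seq_plus'; [|apply log_factor_along].
    apply is_lim_seq_mult'; [apply is_lim_seq_const|].
    apply is_lim_seq_value with (1 * s); [|ring].
    apply (first_order_along exp); [|apply is_lim_seq_rescaled_step].
    rewrite <- exp_0. apply is_derive_exp. }
  assert (Hexp : is_lim_seq (fun n => INR n * (exp (e n) - exp 0))
    (1 * (a * (x / (1 + x)) * s + ((x + x ^ 2) * s ^ 2 / 2 - s * x)))).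
  { apply first_order_along; [|exact He]. rewrite <- exp_0. apply is_derive_exp. }
  assert (He1 : is_lim_seq (fun n => exp (e n)) 1).
  { rewrite <- exp_0. apply is_lim_seq_continuous.
    - apply derivable_continuous_pt, derivable_pt_exp.
    - eapply is_lim_seq_0_of_rescaled, He. }
  apply is_lim_seq_ext_loc with
    (fun n => INR n * (q n - 1) * exp (e n) + INR n * (exp (e n) - exp 0)).
  - generalize (eventually_log_domain x s). apply filter_imp. intros n Hn.
    rewrite exp_0. unfold exp_mean. fold (q n).
    replace (exp (a * (x / (1 + x)) * (exp (s / (INR n + 1)) - 1)) /
       (1 - x * (exp (s / (INR n + 1)) - 1)) ^ n * exp (- (s * x)))
      with (exp (e n)); [ring|].
    unfold e, Rminus at 2. rewrite !exp_plus, <- Ropp_mult_distr_r, exp_Ropp.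
    rewrite exp_INR_mult, exp_ln by lra. unfold Rdiv, Rminus. ring.
  - apply is_lim_seq_value with
      (s / 2 * 1 + 1 * (a * (x / (1 + x)) * s + ((x + x ^ 2) * s ^ 2 / 2 - s * x))).
    2: { unfold drift, diffusion. field. lra. }
    apply is_lim_seq_plus'; [|exact Hexp].
    apply is_lim_seq_mult'; [|exact He1].
    now apply exp_minus_1_ratio_along.
Qed.

(** The local coordinate that replaces [u - x].  Its powers are combinations of
    exponentials, hence have explicit means, and it grows fast enough to
    dominate every polynomial weight. *)
Definition expm1 (x u : R) : R := exp (u - x) - 1.

(** The powers [expm1 ^ j] with [j <= 4] are expanded by the binomial formula
    into exponentials; in the resulting combination of the limits
    [s * drift + s ^ 2 * diffusion / 2], [s = 0, ..., 4], only the 2-jet of the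
    function at [x] survives. *)
Lemma quartic_mean (a x A1 A2 A4 : R) : 0 <= a -> 0 <= x ->
  exists m : nat -> R,
    eventually (fun n => is_mean a n x (fun u =>
      A1 * expm1 x u + A2 * expm1 x u ^ 2 + A4 * expm1 x u ^ 4) (m n)) /\
    is_lim_seq (fun n => INR n * m n)
      (A1 * drift a x + (A1 / 2 + A2) * diffusion x).
Proof.
  intros Ha Hx.
  (* [cj] is the coefficient of [exp (j * (u - x))]. *)
  set (c0 := - A1 + A2 + A4). set (c1 := A1 - 2 * A2 - 4 * A4).
  set (c2 := A2 + 6 * A4). set (c3 := - 4 * A4). set (c4 := A4).
  exists (fun n => c0 + (c1 * exp_mean a x 1 n + (c2 * exp_mean a x 2 n +
    (c3 * exp_mean a x 3 n + c4 * exp_mean a x 4 n)))).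
  split.
  - generalize (filter_and _ _ (eventually_log_domain x 1)
      (filter_and _ _ (eventually_log_domain x 2)
      (filter_and _ _ (eventually_log_domain x 3) (eventually_log_domain x 4)))).
    apply filter_imp. intros n (H1 & H2 & H3 & H4).
    apply is_mean_ext with (fun u => c0 + (c1 * exp (1 * (u - x)) +
      (c2 * exp (2 * (u - x)) + (c3 * exp (3 * (u - x)) + c4 * exp (4 * (u - x)))))).
    + intros u. unfold expm1.
      replace 1 with (INR 1) at 1 by reflexivity.
      replace 2 with (INR 2) by reflexivity.
      replace 3 with (INR 3) by (simpl; ring).
      replace 4 with (INR 4) by (simpl; ring).
      rewrite !exp_INR_mult. unfold c0, c1, c2, c3, c4. simpl. ring.
    + apply is_mean_plus; [apply is_mean_const; assumption|].
      repeat (apply is_mean_plus; [apply is_mean_scal, is_mean_exp; trivial; lra|]).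
      apply is_mean_scal, is_mean_exp; trivial; lra.
  - apply is_lim_seq_ext with (fun n =>
      c1 * (INR n * (exp_mean a x 1 n - 1)) + (c2 * (INR n * (exp_mean a x 2 n - 1)) +
      (c3 * (INR n * (exp_mean a x 3 n - 1)) + c4 * (INR n * (exp_mean a x 4 n - 1))))).
    { intros n. unfold c0, c1, c2, c3, c4. ring. }
    eapply is_lim_seq_value;
      [repeat apply is_lim_seq_plus'; (apply is_lim_seq_mult';
         [apply is_lim_seq_const|apply exp_mean_asymptotics; lra])|].
    unfold c1, c2, c3, c4. field.
Qed.

(** * Averages over rectangular cells *)

Definition cell_avg2 (n : nat) (f : R * R -> R) (k1 k2 : nat) : R :=
  (INR n + 1) * (INR n + 1) *
  RInt (fun v => RInt (fun u => f (u, v))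
      (INR k1 / (INR n + 1)) ((INR k1 + 1) / (INR n + 1)))
    (INR k2 / (INR n + 1)) ((INR k2 + 1) / (INR n + 1)).

Lemma cell_bounds (n k : nat) :
  0 <= INR k / (INR n + 1) < (INR k + 1) / (INR n + 1).
Proof.
  pose proof (INR_succ_pos n). split.
  - apply Rdiv_le_0_compat; [apply pos_INR|assumption].
  - apply Rmult_lt_compat_r; [now apply Rinv_0_lt_compat|lra].
Qed.

Lemma continuous_section (F : R * R -> R) (u v : R) :
  (forall p, continuous F p) -> continuous (fun u => F (u, v)) u.
Proof.
  intros HF. apply (continuous_comp_2 (fun u : R => u) (fun _ => v) (fun u v => F (u, v))).
  - apply continuous_id.
  - apply continuous_const.
  - apply continuous_ext with F; [now intros [? ?]|]. apply HF.
Qed.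

(** Uniform continuity on a compact strip makes the inner integral depend
    continuously on the parameter. *)
Lemma continuous_RInt_section (F : R * R -> R) (b d v0 : R) : b <= d ->
  (forall p, continuous F p) -> continuous (fun v => RInt (fun u => F (u, v)) b d) v0.
Proof.
  intros Hbd HF.
  assert (HC : forall x y, continuity_2d_pt (fun u v => F (u, v)) x y).
  { intros x y. apply continuity_2d_pt_filterlim.
    apply filterlim_ext with F; [now intros [? ?]|]. apply HF. }
  apply (filterlim_locally (fun v => RInt (fun u => F (u, v)) b d)). intros eps.
  assert (He : 0 < eps / (d - b + 1)).
  { apply Rdiv_lt_0_compat; [apply cond_pos|lra]. }
  destruct (uniform_continuity_2d_1d (fun u v => F (u, v)) b d v0
    (fun x _ => HC x v0) (mkposreal _ He)) as [dl Hd]. simpl in Hd.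
  exists dl. intros v Hv.
  unfold ball in Hv; simpl in Hv; unfold AbsRing_ball, abs, minus, plus, opp in Hv;
    simpl in Hv.
  assert (Hv' : v0 - dl <= v <= v0 + dl).
  { apply Rabs_def2 in Hv. lra. }
  unfold ball; simpl; unfold AbsRing_ball, abs, minus, plus, opp; simpl.
  assert (Hi : forall y, is_RInt (fun u => F (u, y)) b d (RInt (fun u => F (u, y)) b d)).
  { intros y. apply is_RInt_everywhere_continuous.
    intros u. now apply continuous_section. }
  apply Rle_lt_trans with ((d - b) * (eps / (d - b + 1))).
  - apply (norm_RInt_le_const (V := R_NormedModule)
      (fun u => F (u, v) - F (u, v0)) b d); [exact Hbd| |].
    + intros u Hu. left.
      pose proof (cond_pos dl).
      apply (Hd u v0 u v); trivial; [lra|].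
      rewrite Rminus_diag, Rabs_R0. assumption.
    + apply (is_RInt_minus (V := R_NormedModule) _ _ _ _ _ _ (Hi v) (Hi v0)).
  - pose proof (cond_pos eps).
    apply Rmult_lt_reg_r with (d - b + 1); [lra|].
    replace ((d - b) * (eps / (d - b + 1)) * (d - b + 1)) with ((d - b) * eps)
      by (field; lra). nra.
Qed.

Lemma cell_avg2_le (n k1 k2 : nat) (F G : R * R -> R) :
  (forall p, continuous F p) -> (forall p, continuous G p) ->
  (forall p, quadrant p -> F p <= G p) ->
  cell_avg2 n F k1 k2 <= cell_avg2 n G k1 k2.
Proof.
  intros HF HG HFG. unfold cell_avg2.
  pose proof (INR_succ_pos n).
  destruct (cell_bounds n k1) as [H1 H1']. destruct (cell_bounds n k2) as [H2 H2'].
  apply Rmult_le_compat_l; [apply Rmult_le_pos; lra|].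
  apply RInt_le; [lra| | |].
  - apply ex_RInt_everywhere_continuous. intros v.
    apply continuous_RInt_section; [lra|exact HF].
  - apply ex_RInt_everywhere_continuous. intros v.
    apply continuous_RInt_section; [lra|exact HG].
  - intros v Hv. apply RInt_le; [lra| | |].
    + apply ex_RInt_everywhere_continuous. intros u. now apply continuous_section.
    + apply ex_RInt_everywhere_continuous. intros u. now apply continuous_section.
    + intros u Hu. apply HFG. split; simpl; lra.
Qed.

Lemma cell_avg2_ext (n k1 k2 : nat) (F G : R * R -> R) :
  (forall p, quadrant p -> F p = G p) ->
  cell_avg2 n F k1 k2 = cell_avg2 n G k1 k2.
Proof.
  intros H. unfold cell_avg2. f_equal.
  destruct (cell_bounds n k1) as [H1 H1']. destruct (cell_bounds n k2) as [H2 H2'].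
  apply RInt_ext. intros v Hv. apply RInt_ext. intros u Hu.
  rewrite Rmin_left, Rmax_right in Hu by lra.
  rewrite Rmin_left, Rmax_right in Hv by lra.
  apply H. split; simpl; lra.
Qed.

(** The comparison functions: sums of univariate functions and of one product,
    so that their means reduce to univariate ones. *)
Definition separable (g1 g2 w1 w2 : R -> R) (c : R) (p : R * R) : R :=
  g1 (fst p) + g2 (snd p) + c * (w1 (fst p) * w2 (snd p)).

Lemma continuous_separable (g1 g2 w1 w2 : R -> R) (c : R) (p : R * R) :
  (forall u, continuous g1 u) -> (forall u, continuous g2 u) ->
  (forall u, continuous w1 u) -> (forall u, continuous w2 u) ->
  continuous (separable g1 g2 w1 w2 c) p.
Proof.
  intros H1 H2 H3 H4.
  assert (Hf : forall g : R -> R, (forall u, continuous g u) ->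
    continuous (fun p : R * R => g (fst p)) p).
  { intros g Hg. apply continuous_comp; [apply continuous_fst|apply Hg]. }
  assert (Hs : forall g : R -> R, (forall u, continuous g u) ->
    continuous (fun p : R * R => g (snd p)) p).
  { intros g Hg. apply continuous_comp; [apply continuous_snd|apply Hg]. }
  apply (continuous_plus (fun p : R * R => g1 (fst p) + g2 (snd p))
    (fun p : R * R => c * (w1 (fst p) * w2 (snd p)))).
  - apply (continuous_plus (fun p : R * R => g1 (fst p)) (fun p : R * R => g2 (snd p)));
      auto.
  - apply (continuous_scal_r c (fun p : R * R => w1 (fst p) * w2 (snd p))).
    apply (continuous_mult (fun p : R * R => w1 (fst p)) (fun p : R * R => w2 (snd p)));
      auto.
Qed.

Lemma cell_avg2_separable (n k1 k2 : nat) (g1 g2 w1 w2 : R -> R) (c : R) :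
  (forall u, continuous g1 u) -> (forall u, continuous g2 u) ->
  (forall u, continuous w1 u) -> (forall u, continuous w2 u) ->
  cell_avg2 n (separable g1 g2 w1 w2 c) k1 k2
  = cell_avg n g1 k1 + cell_avg n g2 k2
    + c * (cell_avg n w1 k1 * cell_avg n w2 k2).
Proof.
  intros H1 H2 H3 H4. pose proof (INR_succ_pos n) as HN.
  unfold cell_avg2, cell_avg, separable; simpl.
  set (b := INR k1 / (INR n + 1)). set (d := (INR k1 + 1) / (INR n + 1)).
  set (b' := INR k2 / (INR n + 1)). set (d' := (INR k2 + 1) / (INR n + 1)).
  assert (Hd : d - b = / (INR n + 1)) by (unfold d, b; field; lra).
  assert (Hd' : d' - b' = / (INR n + 1)) by (unfold d', b'; field; lra).
  assert (HI : forall (g : R -> R) r t, (forall u, continuous g u) ->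
    is_RInt g r t (RInt g r t)).
  { intros g r t Hg. now apply is_RInt_everywhere_continuous. }
  assert (Hin : forall v, RInt (fun u => g1 u + g2 v + c * (w1 u * w2 v)) b d
    = RInt g1 b d + (d - b) * g2 v + c * RInt w1 b d * w2 v).
  { intros v. apply is_RInt_unique.
    apply is_RInt_ext with (fun u => plus (plus (g1 u) (g2 v))
      (scal (c * w2 v) (w1 u))).
    - intros u _. unfold plus, scal; simpl; unfold mult; simpl. ring.
    - replace (c * RInt w1 b d * w2 v) with (scal (c * w2 v) (RInt w1 b d))
        by (unfold scal; simpl; unfold mult; simpl; ring).
      apply (is_RInt_plus (fun u => plus (g1 u) (g2 v)) (fun u => scal (c * w2 v) (w1 u))).
      + apply (is_RInt_plus g1 (fun _ => g2 v)); [now apply HI|].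
        apply (is_RInt_const b d (g2 v)).
      + apply (is_RInt_scal w1). now apply HI. }
  rewrite (RInt_ext _ (fun v => RInt g1 b d + (d - b) * g2 v + c * RInt w1 b d * w2 v))
    by (intros; apply Hin).
  replace (RInt (fun v => RInt g1 b d + (d - b) * g2 v + c * RInt w1 b d * w2 v) b' d')
    with ((d' - b') * RInt g1 b d + (d - b) * RInt g2 b' d'
          + c * RInt w1 b d * RInt w2 b' d').
  - rewrite Hd, Hd'. field. lra.
  - symmetry. apply is_RInt_unique.
    apply (is_RInt_plus (fun v => RInt g1 b d + (d - b) * g2 v)
      (fun v => scal (c * RInt w1 b d) (w2 v))).
    + apply (is_RInt_plus (fun _ => RInt g1 b d) (fun v => scal (d - b) (g2 v))).
      * apply (is_RInt_const b' d' (RInt g1 b d)).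
      * apply (is_RInt_scal g2). now apply HI.
    + apply (is_RInt_scal w2). now apply HI.
Qed.

(** * Iterated series *)

Definition is_double_series (c : nat -> nat -> R) (s : R) : Prop :=
  exists r : nat -> R, (forall i, is_series (c i) (r i)) /\ is_series r s.

Lemma is_double_series_unique (c : nat -> nat -> R) (s : R) :
  is_double_series c s -> Series (fun i => Series (c i)) = s.
Proof.
  intros [r [H1 H2]]. rewrite (Series_ext _ r).
  - now apply is_series_unique.
  - intros i. now apply is_series_unique.
Qed.

Lemma is_double_series_product (u v : nat -> R) (s t : R) :
  is_series u s -> is_series v t ->
  is_double_series (fun i j => u i * v j) (s * t).
Proof.
  intros Hu Hv. exists (fun i => u i * t). split.
  - intros i. apply (is_series_scal_l (u i) v t Hv).
  - apply (is_series_scal_r t u s Hu).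
Qed.

Lemma is_double_series_plus (c d : nat -> nat -> R) (s t : R) :
  is_double_series c s -> is_double_series d t ->
  is_double_series (fun i j => c i j + d i j) (s + t).
Proof.
  intros [r [H1 H2]] [q [H3 H4]]. exists (fun i => r i + q i). split.
  - intros i. now apply (is_series_plus (c i) (d i)).
  - now apply (is_series_plus r q).
Qed.

Lemma is_double_series_ext (c d : nat -> nat -> R) (s : R) :
  (forall i j, c i j = d i j) -> is_double_series c s -> is_double_series d s.
Proof.
  intros E [r [H1 H2]]. exists r. split; [|exact H2].
  intros i. apply is_series_ext with (c i); auto.
Qed.

Lemma is_series_squeeze (l c u : nat -> R) (sl su : R) :
  (forall i, l i <= c i <= u i) -> is_series l sl -> is_series u su ->
  exists s, is_series c s /\ sl <= s <= su.
Proof.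
  intros H Hl Hu.
  assert (Hul : is_series (fun i => u i - l i) (su - sl))
    by exact (is_series_minus u l su sl Hu Hl).
  assert (Hb : forall i, 0 <= c i - l i <= u i - l i)
    by (intros i; specialize (H i); lra).
  assert (Hc : ex_series (fun i => c i - l i)).
  { apply (ex_series_le (fun i => c i - l i) (fun i => u i - l i)).
    - intros i. unfold norm; simpl; unfold abs; simpl.
      rewrite Rabs_pos_eq; apply Hb.
    - eexists. exact Hul. }
  exists (sl + Series (fun i => c i - l i)). split.
  - eapply is_series_eq;
      [exact (is_series_plus _ _ _ _ Hl (Series_correct _ Hc))| |reflexivity].
    intros i. unfold plus; simpl. ring.
  - pose proof (Series_le _ _ Hb (ex_intro _ _ Hul)) as B.
    rewrite (is_series_unique _ _ Hul) in B.
    pose proof (Series_le (fun _ => 0 * 0) (fun i => c i - l i)) as B0.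
    rewrite Series_scal_l in B0.
    specialize (B0 ltac:(intros i; specialize (Hb i); lra) Hc). lra.
Qed.

Lemma is_double_series_squeeze (l c u : nat -> nat -> R) (sl su : R) :
  (forall i j, l i j <= c i j <= u i j) ->
  is_double_series l sl -> is_double_series u su ->
  exists s, is_double_series c s /\ sl <= s <= su.
Proof.
  intros H [rl [Hl1 Hl2]] [ru [Hu1 Hu2]].
  assert (Hc : forall i, is_series (c i) (Series (c i)) /\
    rl i <= Series (c i) <= ru i).
  { intros i. destruct (is_series_squeeze _ _ _ _ _ (H i) (Hl1 i) (Hu1 i))
      as [s [Hs Hb]].
    now rewrite (is_series_unique _ _ Hs). }
  destruct (is_series_squeeze rl (fun i => Series (c i)) ru sl su) as [s [Hs Hb]];
    trivial.
  - intros i. apply Hc.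
  - exists s. split; [|exact Hb]. exists (fun i => Series (c i)). split; [|exact Hs].
    intros i. apply Hc.
Qed.

(** * Bounds for the bivariate operator *)

Lemma separable_mean (a : R) (n : nat) (x y c : R) (g1 g2 w1 w2 : R -> R)
    (m1 m2 l1 l2 : R) : 0 <= a -> 0 <= x -> 0 <= y ->
  is_mean a n x g1 m1 -> is_mean a n y g2 m2 ->
  is_mean a n x w1 l1 -> is_mean a n y w2 l2 ->
  is_double_series (fun k1 k2 => basis2 a n n k1 k2 x y *
      cell_avg2 n (separable g1 g2 w1 w2 c) k1 k2) (m1 + m2 + c * (l1 * l2)).
Proof.
  intros Ha Hx Hy [C1 S1] [C2 S2] [C3 S3] [C4 S4].
  pose proof (is_series_basis a x n Ha Hx) as Bx.
  pose proof (is_series_basis a y n Ha Hy) as By.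
  replace (m1 + m2 + c * (l1 * l2)) with (m1 * 1 + 1 * m2 + (c * l1) * l2) by ring.
  eapply is_double_series_ext.
  2: { apply is_double_series_plus; [apply is_double_series_plus|];
         apply is_double_series_product.
       - exact S1.
       - exact By.
       - exact Bx.
       - exact S2.
       - apply (is_series_scal_l c _ _ S3).
       - exact S4. }
  intros i j. rewrite cell_avg2_separable by assumption.
  unfold basis2, scal; simpl; unfold mult; simpl. ring.
Qed.

(** Extends [f] continuously from the quadrant to the plane, as the integration
    lemmas need continuity on full neighbourhoods of boundary points. *)
Definition clamp (f : R * R -> R) (p : R * R) : R :=
  f (Rmax 0 (fst p), Rmax 0 (snd p)).

Lemma clamp_eq (f : R * R -> R) (p : R * R) : quadrant p -> clamp f p = f p.
Proof.
  destruct p as [u v]. intros [Hu Hv]. simpl in Hu, Hv.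
  unfold clamp; simpl. now rewrite !Rmax_right.
Qed.

Lemma Rmax_0_contract (u u' : R) : Rabs (Rmax 0 u' - Rmax 0 u) <= Rabs (u' - u).
Proof.
  unfold Rmax. destruct (Rle_dec 0 u), (Rle_dec 0 u');
    unfold Rabs; repeat destruct Rcase_abs; lra.
Qed.

Lemma continuous_clamp (f : R * R -> R) :
  continuous_on quadrant f -> forall p, continuous (clamp f) p.
Proof.
  intros Hf [u v].
  assert (Hq : quadrant (Rmax 0 u, Rmax 0 v)) by (split; apply Rmax_l).
  specialize (Hf _ Hq).
  apply (filterlim_locally (clamp f)). intros eps.
  destruct (proj1 (filterlim_locally f _) Hf eps) as [d Hd].
  exists d. intros [u' v'] [Hu Hv]. apply Hd.
  - split; eapply Rle_lt_trans; try apply Rmax_0_contract; [exact Hu|exact Hv].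
  - split; apply Rmax_l.
Qed.

(** Positivity of the operator: separable bounds on the quadrant become bounds
    on the value, and also give the convergence of the iterated series. *)
Lemma kantorovich_bounds (a : R) (n : nat) (x y c : R) (f : R * R -> R)
    (g1 g2 h1 h2 w1 w2 : R -> R) (m1 m2 r1 r2 l1 l2 : R) :
  0 <= a -> 0 <= x -> 0 <= y -> continuous_on quadrant f ->
  is_mean a n x g1 m1 -> is_mean a n y g2 m2 ->
  is_mean a n x h1 r1 -> is_mean a n y h2 r2 ->
  is_mean a n x w1 l1 -> is_mean a n y w2 l2 ->
  (forall p, quadrant p ->
    separable g1 g2 w1 w2 c p <= f p <= separable h1 h2 w1 w2 c p) ->
  m1 + m2 + c * (l1 * l2) <= kantorovich a n n f x y
    <= r1 + r2 + c * (l1 * l2).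
Proof.
  intros Ha Hx Hy Hf Hg1 Hg2 Hh1 Hh2 Hw1 Hw2 H.
  destruct (is_double_series_squeeze
    (fun k1 k2 => basis2 a n n k1 k2 x y *
      cell_avg2 n (separable g1 g2 w1 w2 c) k1 k2)
    (fun k1 k2 => basis2 a n n k1 k2 x y * cell_avg2 n f k1 k2)
    (fun k1 k2 => basis2 a n n k1 k2 x y *
      cell_avg2 n (separable h1 h2 w1 w2 c) k1 k2)
    (m1 + m2 + c * (l1 * l2)) (r1 + r2 + c * (l1 * l2))) as [s [Hs Hb]].
  - intros i j.
    assert (Hp : 0 <= basis2 a n n i j x y)
      by (apply Rmult_le_pos; now apply basis_nonneg).
    rewrite <- (cell_avg2_ext n i j (clamp f) f) by apply clamp_eq.
    pose proof (continuous_clamp f Hf) as Hc.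
    split; apply Rmult_le_compat_l; trivial; apply cell_avg2_le; trivial.
    + intros p. apply continuous_separable; [apply Hg1|apply Hg2|apply Hw1|apply Hw2].
    + intros p Hq. rewrite clamp_eq by exact Hq. now apply H.
    + intros p. apply continuous_separable; [apply Hh1|apply Hh2|apply Hw1|apply Hw2].
    + intros p Hq. rewrite clamp_eq by exact Hq. now apply H.
  - now apply separable_mean.
  - now apply separable_mean.
  - replace (kantorovich a n n f x y) with s; [exact Hb|].
    rewrite <- (is_double_series_unique _ _ Hs). unfold kantorovich, cell_avg2.
    rewrite <- Series_scal_l. apply Series_ext. intros i.
    rewrite <- Series_scal_l. apply Series_ext. intros j. ring.
Qed.

(** * Derivatives on the closed half line *)

Lemma is_derive_on_half_line_iff (g : R -> R) (x l : R) : 0 <= x ->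
  is_derive_on half_line g x l <->
  (forall eps : posreal, exists d : posreal, forall y, 0 <= y -> Rabs (y - x) < d ->
    Rabs (g y - g x - (y - x) * l) <= eps * Rabs (y - x)).
Proof.
  intros Hx. split.
  - intros [_ H] eps.
    destruct (H x (fun P HP => filter_le_within half_line P HP) eps) as [d Hd].
    exists d. intros y Hy Hyx. exact (Hd y Hyx Hy).
  - intros H. split; [exact (@is_linear_scal_l R_AbsRing R_NormedModule _)|].
    intros x' Hx' eps.
    assert (Ex : x' = x).
    { destruct (Req_dec x x') as [->|Hne]; [reflexivity|exfalso].
      assert (Hp : 0 < Rabs (x - x')) by (apply Rabs_pos_lt; lra).
      pose proof (Hx' _ (locally_ball x' (mkposreal _ Hp))) as Hb.
      apply locally_singleton in Hb. specialize (Hb Hx).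
      apply (Rlt_irrefl (Rabs (x - x'))). exact Hb. }
    subst x'. destruct (H eps) as [d Hd]. exists d. intros y Hyx Hy.
    exact (Hd y Hy Hyx).
Qed.

Lemma is_derive_on_of_is_derive (g : R -> R) (x l : R) : 0 <= x ->
  is_derive g x l -> is_derive_on half_line g x l.
Proof.
  intros Hx [_ H]. apply is_derive_on_half_line_iff; [exact Hx|].
  intros eps. destruct (H x (fun P HP => HP) eps) as [d Hd].
  exists d. intros y _ Hyx. exact (Hd y Hyx).
Qed.

Lemma is_derive_on_minus (g h : R -> R) (x l m : R) : 0 <= x ->
  is_derive_on half_line g x l -> is_derive_on half_line h x m ->
  is_derive_on half_line (fun t => g t - h t) x (l - m).
Proof.
  intros Hx Hg Hh.
  rewrite is_derive_on_half_line_iff in * by exact Hx.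
  intros eps. destruct (Hg (pos_div_2 eps)) as [d1 H1].
  destruct (Hh (pos_div_2 eps)) as [d2 H2].
  exists (mkposreal _ (Rmin_stable_in_posreal d1 d2)). simpl.
  intros y Hy Hyx.
  specialize (H1 y Hy (Rlt_le_trans _ _ _ Hyx (Rmin_l _ _))).
  specialize (H2 y Hy (Rlt_le_trans _ _ _ Hyx (Rmin_r _ _))). simpl in H1, H2.
  replace (g y - h y - (g x - h x) - (y - x) * (l - m))
    with ((g y - g x - (y - x) * l) - (h y - h x - (y - x) * m)) by ring.
  eapply Rle_trans; [apply Rabs_triang|]. rewrite Rabs_Ropp. lra.
Qed.

Lemma is_derive_on_unique (g : R -> R) (x l m : R) : 0 <= x ->
  is_derive_on half_line g x l -> is_derive_on half_line g x m -> l = m.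
Proof.
  intros Hx Hl Hm.
  rewrite is_derive_on_half_line_iff in * by exact Hx.
  destruct (Req_dec l m) as [E|Hne]; [exact E|exfalso].
  assert (He : 0 < Rabs (l - m) / 4).
  { assert (0 < Rabs (l - m)) by (apply Rabs_pos_lt; lra). lra. }
  destruct (Hl (mkposreal _ He)) as [d1 H1].
  destruct (Hm (mkposreal _ He)) as [d2 H2]. simpl in H1, H2.
  pose proof (Rmin_stable_in_posreal d1 d2) as Hd.
  set (d := Rmin d1 d2 / 2). assert (Hd0 : 0 < d) by (unfold d; lra).
  pose proof (Rmin_l d1 d2). pose proof (Rmin_r d1 d2).
  assert (E : x + d - x = d) by ring.
  specialize (H1 (x + d)). specialize (H2 (x + d)).
  rewrite E, (Rabs_pos_eq d) in H1, H2 by lra.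
  specialize (H1 ltac:(lra) ltac:(unfold d; lra)).
  specialize (H2 ltac:(lra) ltac:(unfold d; lra)).
  assert (H3 : Rabs (d * (l - m)) <= 2 * (Rabs (l - m) / 4 * d)).
  { replace (d * (l - m)) with ((g (x + d) - g x - d * m) - (g (x + d) - g x - d * l))
      by ring.
    eapply Rle_trans; [apply Rabs_triang|]. rewrite Rabs_Ropp. lra. }
  rewrite Rabs_mult, (Rabs_pos_eq d) in H3 by lra. nra.
Qed.

Lemma Derive_on_correct (g : R -> R) (x : R) : 0 <= x ->
  ex_derive_on half_line g x ->
  is_derive_on half_line g x (Derive_on half_line g x).
Proof.
  intros Hx [l Hl].
  apply (iota_correct (V := R_CompleteNormedModule)
    (fun l => is_derive_on half_line g x l)).
  exists l. split; [exact Hl|]. intros m Hm. now apply (is_derive_on_unique g x).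
Qed.

(** The mean value theorem is applied to [t |-> g (Rmax 0 t)], which has the
    same derivative at positive points and is continuous at [0] in the two-sided
    sense. *)
Lemma mean_value_half_line (g dg : R -> R) (x u : R) :
  (forall t, 0 <= t -> is_derive_on half_line g t (dg t)) ->
  0 <= x -> 0 <= u ->
  exists xi, Rmin x u <= xi <= Rmax x u /\ g u - g x = dg xi * (u - x).
Proof.
  intros H Hx Hu.
  assert (H0 : 0 <= Rmin x u) by now apply Rmin_glb.
  destruct (MVT_gen (fun t => g (Rmax 0 t)) x u dg) as [xi [Hxi E]].
  - intros t [Ht _].
    assert (Ht0 : 0 < t) by lra.
    pose proof (proj1 (is_derive_on_half_line_iff g t (dg t) (Rlt_le _ _ Ht0))
      (H t (Rlt_le _ _ Ht0))) as D.
    split; [exact (@is_linear_scal_l R_AbsRing R_NormedModule _)|].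
    intros t' Ht'. 
    apply (@is_filter_lim_locally_unique R_AbsRing R_NormedModule) in Ht'. subst t'.
    intros eps. destruct (D eps) as [d Hd].
    exists (mkposreal _ (Rmin_stable_in_posreal d (mkposreal t Ht0))).
    intros y Hy.
    unfold ball in Hy; simpl in Hy; unfold AbsRing_ball, abs, minus, plus, opp in Hy;
      simpl in Hy.
    pose proof (Rmin_l d t). pose proof (Rmin_r d t).
    assert (Hy0 : 0 <= y).
    { destruct (Rabs_def2 _ _ Hy). lra. }
    rewrite !Rmax_right by lra. apply (Hd y Hy0).
    eapply Rlt_le_trans; [exact Hy|apply Rmin_l].
  - intros t [Ht _]. assert (Ht0 : 0 <= t) by lra.
    pose proof (proj1 (is_derive_on_half_line_iff g t (dg t) Ht0) (H t Ht0)) as D.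
    apply continuity_pt_filterlim.
    apply (filterlim_locally (fun t => g (Rmax 0 t))). intros eps.
    destruct (D (mkposreal 1 Rlt_0_1)) as [d Hd]. simpl in Hd.
    assert (Hl : 0 < Rabs (dg t) + 1) by (pose proof (Rabs_pos (dg t)); lra).
    assert (He : 0 < eps / (Rabs (dg t) + 1))
      by (apply Rdiv_lt_0_compat; [apply cond_pos|exact Hl]).
    exists (mkposreal _ (Rmin_stable_in_posreal d (mkposreal _ He))).
    intros y Hy.
    unfold ball in Hy |- *; simpl in Hy |- *;
      unfold AbsRing_ball, abs, minus, plus, opp in Hy |- *; simpl in Hy |- *.
    pose proof (Rmax_0_contract t y) as Hc.
    rewrite (Rmax_right 0 t) in * by exact Ht0.
    assert (Hy1 : Rabs (Rmax 0 y - t) < d).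
    { eapply Rle_lt_trans; [exact Hc|]. eapply Rlt_le_trans; [exact Hy|apply Rmin_l]. }
    assert (Hy2 : Rabs (Rmax 0 y - t) < eps / (Rabs (dg t) + 1)).
    { eapply Rle_lt_trans; [exact Hc|]. eapply Rlt_le_trans; [exact Hy|apply Rmin_r]. }
    specialize (Hd _ (Rmax_l 0 y) Hy1).
    replace (g (Rmax 0 y) + - g t)
      with ((g (Rmax 0 y) - g t - (Rmax 0 y - t) * dg t) + (Rmax 0 y - t) * dg t)
      by ring.
    eapply Rle_lt_trans; [apply Rabs_triang|]. rewrite Rabs_mult.
    apply Rle_lt_trans with ((Rabs (dg t) + 1) * Rabs (Rmax 0 y - t)); [lra|].
    apply Rmult_lt_reg_l with (/ (Rabs (dg t) + 1)); [now apply Rinv_0_lt_compat|].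
    rewrite <- Rmult_assoc, Rinv_l, Rmult_1_l by lra.
    rewrite Rmult_comm. exact Hy2.
  - exists xi. split; [exact Hxi|].
    rewrite !Rmax_right in E by assumption. exact E.
Qed.

Lemma between_dist (x u t : R) : Rmin x u <= t <= Rmax x u ->
  Rabs (t - x) <= Rabs (u - x).
Proof.
  unfold Rmin, Rmax. destruct (Rle_dec x u); intros H;
    unfold Rabs; repeat destruct Rcase_abs; lra.
Qed.

Lemma first_order_half_line (g dg : R -> R) (x u eps : R) :
  (forall t, 0 <= t -> is_derive_on half_line g t (dg t)) ->
  0 <= x -> 0 <= u ->
  (forall t, 0 <= t -> Rabs (t - x) <= Rabs (u - x) -> Rabs (dg t) <= eps) ->
  Rabs (g u - g x) <= eps * Rabs (u - x).
Proof.
  intros H Hx Hu Hb.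
  destruct (mean_value_half_line g dg x u H Hx Hu) as [xi [Hxi ->]].
  rewrite Rabs_mult. apply Rmult_le_compat_r; [apply Rabs_pos|].
  apply Hb; [|now apply between_dist].
  apply Rle_trans with (Rmin x u); [now apply Rmin_glb|apply Hxi].
Qed.

Lemma second_order_half_line (g g1 g2 : R -> R) (x u eps : R) :
  (forall t, 0 <= t -> is_derive_on half_line g t (g1 t)) ->
  (forall t, 0 <= t -> is_derive_on half_line g1 t (g2 t)) ->
  0 <= x -> 0 <= u ->
  (forall t, 0 <= t -> Rabs (t - x) <= Rabs (u - x) -> Rabs (g2 t) <= eps) ->
  Rabs (g u - g x - g1 x * (u - x)) <= eps * (u - x) ^ 2.
Proof.
  intros H1 H2 Hx Hu Hb.
  destruct (mean_value_half_line g g1 x u H1 Hx Hu) as [xi [Hxi E]].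
  assert (Hxi0 : 0 <= xi).
  { apply Rle_trans with (Rmin x u); [now apply Rmin_glb|apply Hxi]. }
  pose proof (between_dist _ _ _ Hxi) as Hd.
  replace (g u - g x - g1 x * (u - x)) with ((g1 xi - g1 x) * (u - x))
    by (rewrite E; ring).
  rewrite Rabs_mult.
  replace ((u - x) ^ 2) with (Rabs (u - x) * Rabs (u - x))
    by (rewrite <- pow2_abs; ring).
  rewrite <- Rmult_assoc. apply Rmult_le_compat_r; [apply Rabs_pos|].
  assert (B : Rabs (g1 xi - g1 x) <= eps * Rabs (xi - x)).
  { apply (first_order_half_line g1 g2); trivial.
    intros t Ht Htx. apply Hb; [exact Ht|lra]. }
  assert (He : 0 <= eps).
  { eapply Rle_trans; [apply Rabs_pos|].
    apply (Hb x Hx). rewrite Rminus_diag, Rabs_R0. apply Rabs_pos. }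
  apply Rle_trans with (1 := B). now apply Rmult_le_compat_l.
Qed.

(** * The second order expansion on the quadrant *)

Definition is_partial_x (f fx : R * R -> R) : Prop := forall u v, 0 <= u -> 0 <= v ->
  is_derive_on half_line (fun t => f (t, v)) u (fx (u, v)).

Definition is_partial_y (f fy : R * R -> R) : Prop := forall u v, 0 <= u -> 0 <= v ->
  is_derive_on half_line (fun t => f (u, t)) v (fy (u, v)).

Lemma partial_x_correct (f : R * R -> R) :
  (forall p, quadrant p -> ex_partial_x f p) -> is_partial_x f (partial_x f).
Proof.
  intros H u v Hu Hv. apply Derive_on_correct; [exact Hu|].
  apply (H (u, v)). now split.
Qed.

Lemma partial_y_correct (f : R * R -> R) :
  (forall p, quadrant p -> ex_partial_y f p) -> is_partial_y f (partial_y f).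
Proof.
  intros H u v Hu Hv. apply Derive_on_correct; [exact Hv|].
  apply (H (u, v)). now split.
Qed.

Lemma is_partial_x_minus (f g fx gx : R * R -> R) :
  is_partial_x f fx -> is_partial_x g gx ->
  is_partial_x (fun p => f p - g p) (fun p => fx p - gx p).
Proof. intros Hf Hg u v Hu Hv. apply is_derive_on_minus; auto. Qed.

Lemma is_partial_y_minus (f g fy gy : R * R -> R) :
  is_partial_y f fy -> is_partial_y g gy ->
  is_partial_y (fun p => f p - g p) (fun p => fy p - gy p).
Proof. intros Hf Hg u v Hu Hv. apply is_derive_on_minus; auto. Qed.

(** The path from [(x, y)] to [(u, v)] goes first along the first axis; this is
    why, of the mixed derivatives, only the one of [Gy] in the first variable
    enters. *)
Lemma zero_jet_bound (G Gx Gy Gxx Gxy Gyy : R * R -> R) (x y u v d eps : R) :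
  is_partial_x G Gx -> is_partial_x Gx Gxx ->
  is_partial_y G Gy -> is_partial_y Gy Gyy -> is_partial_x Gy Gxy ->
  0 <= x -> 0 <= y -> 0 <= u -> 0 <= v ->
  G (x, y) = 0 -> Gx (x, y) = 0 -> Gy (x, y) = 0 ->
  (forall s t, 0 <= s -> 0 <= t -> Rabs (s - x) < d -> Rabs (t - y) < d ->
    Rabs (Gxx (s, t)) <= eps /\ Rabs (Gxy (s, t)) <= eps /\ Rabs (Gyy (s, t)) <= eps) ->
  Rabs (u - x) < d -> Rabs (v - y) < d ->
  Rabs (G (u, v)) <= 2 * eps * ((u - x) ^ 2 + (v - y) ^ 2).
Proof.
  intros Hx Hxx Hy Hyy Hxy x0 y0 u0 v0 E Ex Ey Hb Hu Hv.
  assert (Hyd : Rabs (y - y) < d).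
  { rewrite Rminus_diag, Rabs_R0. eapply Rle_lt_trans; [apply Rabs_pos|exact Hu]. }
  assert (B1 : Rabs (G (u, v) - G (u, y) - Gy (u, y) * (v - y)) <= eps * (v - y) ^ 2).
  { apply (second_order_half_line (fun t => G (u, t)) (fun t => Gy (u, t))
      (fun t => Gyy (u, t))); trivial.
    - intros t Ht. now apply Hy.
    - intros t Ht. now apply Hyy.
    - intros t Ht Htd. apply Hb; trivial. lra. }
  assert (B2 : Rabs (Gy (u, y) - Gy (x, y)) <= eps * Rabs (u - x)).
  { apply (first_order_half_line (fun s => Gy (s, y)) (fun s => Gxy (s, y))); trivial.
    - intros s Hs. now apply Hxy.
    - intros s Hs Hsd. apply Hb; trivial. lra. }
  assert (B3 : Rabs (G (u, y) - G (x, y) - Gx (x, y) * (u - x)) <= eps * (u - x) ^ 2).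
  { apply (second_order_half_line (fun s => G (s, y)) (fun s => Gx (s, y))
      (fun s => Gxx (s, y))); trivial.
    - intros s Hs. now apply Hx.
    - intros s Hs. now apply Hxx.
    - intros s Hs Hsd. apply Hb; trivial. lra. }
  rewrite E, Ex, Rmult_0_l, !Rminus_0_r in B3. rewrite Ey, Rminus_0_r in B2.
  replace (G (u, v)) with ((G (u, v) - G (u, y) - Gy (u, y) * (v - y))
    + G (u, y) + Gy (u, y) * (v - y)) by ring.
  assert (B4 : Rabs (Gy (u, y) * (v - y)) <= eps * (Rabs (u - x) * Rabs (v - y))).
  { rewrite Rabs_mult, <- Rmult_assoc. apply Rmult_le_compat_r; [apply Rabs_pos|exact B2]. }
  assert (He : 0 <= eps).
  { eapply Rle_trans; [apply Rabs_pos|apply (Hb x y)]; trivial.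
    rewrite Rminus_diag in *. exact Hyd. }
  eapply Rle_trans; [apply Rabs_triang|].
  apply Rle_trans with (eps * (v - y) ^ 2 + eps * (u - x) ^ 2
    + eps * (Rabs (u - x) * Rabs (v - y))).
  - apply Rplus_le_compat; [|exact B4].
    eapply Rle_trans; [apply Rabs_triang|]. lra.
  - rewrite <- (pow2_abs (u - x)), <- (pow2_abs (v - y)).
    generalize (Rabs (u - x)) (Rabs (v - y)). intros p q.
    pose proof (pow2_ge_0 (p - q)). pose proof (pow2_ge_0 p). pose proof (pow2_ge_0 q).
    nra.
Qed.

Lemma continuous_on_near (h : R * R -> R) (x y : R) (eps : posreal) :
  continuous_on quadrant h -> 0 <= x -> 0 <= y ->
  exists d : posreal, forall s t, 0 <= s -> 0 <= t ->
    Rabs (s - x) < d -> Rabs (t - y) < d -> Rabs (h (s, t) - h (x, y)) <= eps.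
Proof.
  intros Hh Hx Hy.
  destruct (proj1 (filterlim_locally h _) (Hh (x, y) (conj Hx Hy)) eps) as [d Hd].
  exists d. intros s t Hs Ht Hsx Hty. left.
  apply (Hd (s, t)); [split; assumption|split; assumption].
Qed.

Lemma expm1_far (x u d : R) : 0 <= d <= 1 -> d <= Rabs (u - x) ->
  d <= 2 * Rabs (expm1 x u).
Proof.
  unfold expm1. generalize (u - x). intros p Hd Hp.
  pose proof (exp_ineq1_le p) as H1. pose proof (exp_ineq1_le (- p)) as H2.
  pose proof (exp_pos p) as H0.
  assert (H3 : exp p * exp (- p) = 1)
    by (rewrite <- exp_plus, Rplus_opp_r; apply exp_0).
  unfold Rabs in Hp |- *. destruct (Rcase_abs p), (Rcase_abs (exp p - 1)); nra.
Qed.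

Lemma expm1_near (x u : R) : Rabs (u - x) <= 1 -> (u - x) ^ 2 <= 4 * expm1 x u ^ 2.
Proof.
  intros H.
  pose proof (expm1_far x u (Rabs (u - x)) (conj (Rabs_pos _) H) (Rle_refl _)) as B.
  rewrite <- (pow2_abs (u - x)), <- (pow2_abs (expm1 x u)).
  pose proof (Rabs_pos (u - x)). nra.
Qed.

Definition jet (A C : R) (x u : R) : R := A * expm1 x u + C / 2 * expm1 x u ^ 2.

(** The part without constant term of a quadratic polynomial in the coordinates
    [expm1 x] and [expm1 y]. *)
Definition jet2 (A B C D E x y : R) : R * R -> R :=
  separable (jet A C x) (jet B E y) (expm1 x) (expm1 y) D.

(** The difference of [f] and the polynomial has a vanishing 2-jet at [(x, y)],
    so [zero_jet_bound] applies to it.  The diagonal second order coefficients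
    are shifted by the first order ones because
    [expm1 x u = (u - x) + (u - x) ^ 2 / 2 + o((u - x) ^ 2)]. *)
Lemma quadratic_expansion_local (f fx fy fxx fxy fyy : R * R -> R) (x y : R)
    (eps : posreal) :
  is_partial_x f fx -> is_partial_x fx fxx ->
  is_partial_y f fy -> is_partial_y fy fyy -> is_partial_x fy fxy ->
  continuous_on quadrant fxx -> continuous_on quadrant fxy ->
  continuous_on quadrant fyy -> 0 <= x -> 0 <= y ->
  exists d : posreal, forall u v, 0 <= u -> 0 <= v ->
    Rabs (u - x) < d -> Rabs (v - y) < d ->
    Rabs (f (u, v) - f (x, y) - jet2 (fx (x, y)) (fy (x, y)) (fxx (x, y) - fx (x, y))
       (fxy (x, y)) (fyy (x, y) - fy (x, y)) x y (u, v))
    <= eps * (expm1 x u ^ 2 + expm1 y v ^ 2).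
Proof.
  intros Hx Hxx Hy Hyy Hxy Cxx Cxy Cyy x0 y0.
  set (A := fx (x, y)). set (B := fy (x, y)). set (C := fxx (x, y) - A).
  set (D := fxy (x, y)). set (E := fyy (x, y) - B).
  set (W := fun p : R * R => exp (fst p - x)). set (Z := fun p : R * R => exp (snd p - y)).
  set (T := fun p : R * R => f (x, y) + (A * (W p - 1) + C / 2 * (W p - 1) ^ 2
    + (B * (Z p - 1) + E / 2 * (Z p - 1) ^ 2) + D * ((W p - 1) * (Z p - 1)))).
  set (Tx := fun p => (A + C * (W p - 1) + D * (Z p - 1)) * W p).
  set (Ty := fun p => (B + E * (Z p - 1) + D * (W p - 1)) * Z p).
  set (Txx := fun p => (A + C * (2 * W p - 1) + D * (Z p - 1)) * W p).
  set (Tyy := fun p => (B + E * (2 * Z p - 1) + D * (W p - 1)) * Z p).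
  set (Txy := fun p => D * W p * Z p).
  assert (TX : is_partial_x T Tx /\ is_partial_x Tx Txx /\ is_partial_x Ty Txy).
  { split; [|split]; intros u v Hu Hv; apply is_derive_on_of_is_derive; trivial;
      unfold T, Tx, Ty, Txx, Txy, W, Z; simpl; auto_derive; trivial;
      unfold Rminus; field. }
  assert (TY : is_partial_y T Ty /\ is_partial_y Ty Tyy).
  { split; intros u v Hu Hv; apply is_derive_on_of_is_derive; trivial;
      unfold T, Tx, Ty, Tyy, W, Z; simpl; auto_derive; trivial;
      unfold Rminus; field. }
  destruct TX as (HTx & HTxx & HTxy). destruct TY as (HTy & HTyy).
  assert (CW : forall p, continuous W p).
  { intros p. apply (continuous_comp (fun p : R * R => fst p) (fun u => exp (u - x))).
    - apply continuous_fst.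
    - apply (ex_derive_continuous (fun u => exp (u - x))). auto_derive. trivial. }
  assert (CZ : forall p, continuous Z p).
  { intros p. apply (continuous_comp (fun p : R * R => snd p) (fun u => exp (u - y))).
    - apply continuous_snd.
    - apply (ex_derive_continuous (fun u => exp (u - y))). auto_derive. trivial. }
  assert (Cm : forall g h : R * R -> R, (forall p, continuous g p) ->
    (forall p, continuous h p) -> forall p, continuous (fun p => g p * h p) p).
  { intros g h Hg Hh p. now apply (continuous_mult g h). }
  assert (Ca : forall g h : R * R -> R, (forall p, continuous g p) ->
    (forall p, continuous h p) -> forall p, continuous (fun p => g p + h p) p).
  { intros g h Hg Hh p. now apply (continuous_plus g h). }
  assert (Ck : forall (c : R) (p : R * R), continuous (fun _ => c) p)
    by (intros; apply continuous_const).
  assert (HV : forall p, continuous Txx p /\ continuous Tyy p /\ continuous Txy p).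
  { intros p. unfold Txx, Tyy, Txy, Rminus.
    split; [|split]; revert p; repeat first [assumption | apply Ck | apply Cm | apply Ca]. }
  assert (He : 0 < eps / 16) by (pose proof (cond_pos eps); lra).
  set (e := mkposreal _ He).
  assert (Hn : forall h h' : R * R -> R, continuous_on quadrant h ->
    (forall p, continuous h' p) -> h (x, y) = h' (x, y) ->
    exists d : posreal, forall s t, 0 <= s -> 0 <= t ->
      Rabs (s - x) < d -> Rabs (t - y) < d -> Rabs (h (s, t) - h' (s, t)) <= eps / 8).
  { intros h h' Hh Hh' Eh.
    destruct (continuous_on_near h x y e Hh x0 y0) as [d1 H1].
    destruct (continuous_on_near h' x y e
      (continuous_on_forall _ _ (fun p _ => Hh' p)) x0 y0) as [d2 H2].
    exists (mkposreal _ (Rmin_stable_in_posreal d1 d2)). simpl.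
    intros s t Hs Ht Hsx Hty.
    specialize (H1 s t Hs Ht (Rlt_le_trans _ _ _ Hsx (Rmin_l _ _))
      (Rlt_le_trans _ _ _ Hty (Rmin_l _ _))).
    specialize (H2 s t Hs Ht (Rlt_le_trans _ _ _ Hsx (Rmin_r _ _))
      (Rlt_le_trans _ _ _ Hty (Rmin_r _ _))).
    simpl in H1, H2.
    replace (h (s, t) - h' (s, t))
      with ((h (s, t) - h (x, y)) - (h' (s, t) - h' (x, y))) by (rewrite Eh; ring).
    eapply Rle_trans; [apply Rabs_triang|]. rewrite Rabs_Ropp. lra. }
  assert (EW : W (x, y) = 1) by (unfold W; simpl; rewrite Rminus_diag; apply exp_0).
  assert (EZ : Z (x, y) = 1) by (unfold Z; simpl; rewrite Rminus_diag; apply exp_0).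
  destruct (Hn fxx Txx Cxx (fun p => proj1 (HV p))) as [d1 D1].
  { unfold Txx. rewrite EW, EZ. unfold C. ring. }
  destruct (Hn fyy Tyy Cyy (fun p => proj1 (proj2 (HV p)))) as [d2 D2].
  { unfold Tyy. rewrite EW, EZ. unfold E. ring. }
  destruct (Hn fxy Txy Cxy (fun p => proj2 (proj2 (HV p)))) as [d3 D3].
  { unfold Txy. rewrite EW, EZ. unfold D. ring. }
  set (d := Rmin (Rmin d1 d2) (Rmin d3 1)).
  assert (Hd : 0 < d).
  { unfold d. repeat apply Rmin_glb_lt; try apply cond_pos. lra. }
  assert (L1 : d <= d1) by (eapply Rle_trans; [apply Rmin_l|apply Rmin_l]).
  assert (L2 : d <= d2) by (eapply Rle_trans; [apply Rmin_l|apply Rmin_r]).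
  assert (L3 : d <= d3) by (eapply Rle_trans; [apply Rmin_r|apply Rmin_l]).
  assert (L4 : d <= 1) by (eapply Rle_trans; [apply Rmin_r|apply Rmin_r]).
  exists (mkposreal d Hd). simpl. intros u v Hu Hv Hux Hvy.
  replace (f (u, v) - f (x, y) - jet2 A B C D E x y (u, v))
    with (f (u, v) - T (u, v))
    by (unfold T, jet2, separable, jet, expm1, W, Z; simpl; ring).
  pose proof (zero_jet_bound _ _ _ _ _ _ x y u v d (eps / 8)
    (is_partial_x_minus _ _ _ _ Hx HTx) (is_partial_x_minus _ _ _ _ Hxx HTxx)
    (is_partial_y_minus _ _ _ _ Hy HTy) (is_partial_y_minus _ _ _ _ Hyy HTyy)
    (is_partial_x_minus _ _ _ _ Hxy HTxy) x0 y0 Hu Hv) as HB.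
  eapply Rle_trans; [apply HB; trivial|].
  - unfold T. rewrite EW, EZ. field.
  - unfold Tx. rewrite EW, EZ. unfold A. ring.
  - unfold Ty. rewrite EW, EZ. unfold B. ring.
  - intros s t Hs Ht Hsx Hty. repeat split; [apply D1|apply D3|apply D2]; trivial; lra.
  - pose proof (expm1_near x u ltac:(lra)). pose proof (expm1_near y v ltac:(lra)).
    pose proof (cond_pos eps). nra.
Qed.

Lemma pow_le_fact_exp (g : nat) (u : R) : 0 <= u -> u ^ g <= INR (fact g) * exp u.
Proof.
  intros Hu. pose proof (INR_fact_lt_0 g) as Hg.
  apply Rmult_le_reg_l with (/ INR (fact g)); [now apply Rinv_0_lt_compat|].
  rewrite <- Rmult_assoc, Rinv_l, Rmult_1_l by lra.
  eapply Rle_trans; [|apply (exp_ge_taylor u g Hu)].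
  destruct g as [|g]; [simpl; lra|]. rewrite tech5.
  assert (0 <= sum_f_R0 (fun k => u ^ k / INR (fact k)) g).
  { apply cond_pos_sum. intros k. apply Rdiv_le_0_compat; [now apply pow_le|].
    apply INR_fact_lt_0. }
  unfold Rdiv at 2. lra.
Qed.

(** A weight [1 + u ^ g] is at most [(1 + g!) * exp u]. *)
Lemma weighted_growth (g1 g2 : nat) (f : R * R -> R) :
  bounded_on quadrant (fun p => omega2 g1 g2 p * f p) ->
  exists K, 0 <= K /\ forall u v, 0 <= u -> 0 <= v ->
    Rabs (f (u, v)) <= K * (exp u * exp v).
Proof.
  intros [M HM].
  assert (HM0 : 0 <= M).
  { eapply Rle_trans; [apply Rabs_pos|apply (HM (0, 0))]. split; simpl; lra. }
  assert (Hw : forall g u, 0 <= u -> 0 < 1 + u ^ g <= (1 + INR (fact g)) * exp u).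
  { intros g u Hu. pose proof (pow_le_fact_exp g u Hu). pose proof (pow_le u g Hu).
    pose proof (exp_ineq1_le u). lra. }
  pose proof (INR_fact_lt_0 g1). pose proof (INR_fact_lt_0 g2).
  exists (M * ((1 + INR (fact g1)) * (1 + INR (fact g2)))). split.
  { apply Rmult_le_pos; [exact HM0|]. apply Rmult_le_pos; lra. }
  intros u v Hu Hv.
  destruct (Hw g1 u Hu) as [P1 Q1]. destruct (Hw g2 v Hv) as [P2 Q2].
  specialize (HM (u, v) (conj Hu Hv)).
  unfold omega2, omega in HM; simpl in HM.
  replace (f (u, v)) with ((1 + u ^ g1) * (1 + v ^ g2)
    * (/ (1 + u ^ g1) * / (1 + v ^ g2) * f (u, v))) by (field; lra).
  rewrite Rabs_mult, (Rabs_pos_eq ((1 + u ^ g1) * (1 + v ^ g2)))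
    by (apply Rmult_le_pos; lra).
  replace (M * ((1 + INR (fact g1)) * (1 + INR (fact g2))) * (exp u * exp v))
    with (((1 + INR (fact g1)) * exp u) * ((1 + INR (fact g2)) * exp v) * M) by ring.
  apply Rmult_le_compat; trivial.
  - apply Rmult_le_pos; lra.
  - apply Rabs_pos.
  - apply Rmult_le_compat; lra.
Qed.

Lemma le_1_plus_squares (w z : R) : Rabs w <= 1 + (w ^ 2 + z ^ 2) /\
  Rabs z <= 1 + (w ^ 2 + z ^ 2) /\ Rabs (w * z) <= 1 + (w ^ 2 + z ^ 2).
Proof.
  rewrite Rabs_mult, <- (pow2_abs w), <- (pow2_abs z).
  pose proof (Rabs_pos w). pose proof (Rabs_pos z). nra.
Qed.

Lemma jet2_growth (A B C D E x y u v : R) :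
  Rabs (jet2 A B C D E x y (u, v))
  <= (Rabs A + Rabs B + Rabs (C / 2) + Rabs D + Rabs (E / 2))
     * (1 + (expm1 x u ^ 2 + expm1 y v ^ 2)).
Proof.
  unfold jet2, separable, jet; simpl fst; simpl snd.
  generalize (expm1 x u) (expm1 y v). intros w z.
  destruct (le_1_plus_squares w z) as (Hw & Hz & Hwz).
  pose proof (pow2_ge_0 w). pose proof (pow2_ge_0 z).
  assert (H2 : forall c r s, Rabs r <= s -> Rabs (c * r) <= Rabs c * s).
  { intros c r s Hr. rewrite Rabs_mult. apply Rmult_le_compat_l; [apply Rabs_pos|exact Hr]. }
  set (S := 1 + (w ^ 2 + z ^ 2)) in *.
  assert (T1 := H2 A w S Hw). assert (T2 := H2 B z S Hz). assert (T3 := H2 D _ S Hwz).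
  assert (T4 : Rabs (C / 2 * w ^ 2) <= Rabs (C / 2) * S)
    by (apply H2; rewrite Rabs_pos_eq; unfold S; lra).
  assert (T5 : Rabs (E / 2 * z ^ 2) <= Rabs (E / 2) * S)
    by (apply H2; rewrite Rabs_pos_eq; unfold S; lra).
  repeat (eapply Rle_trans; [apply Rabs_triang|]).
  pose proof (Rabs_triang (A * w) (C / 2 * w ^ 2)).
  pose proof (Rabs_triang (B * z) (E / 2 * z ^ 2)).
  pose proof (Rabs_triang (A * w + C / 2 * w ^ 2) (B * z + E / 2 * z ^ 2)).
  lra.
Qed.

(** Near [(x, y)] this is the local expansion.  Away from it,
    [S = expm1 x u ^ 2 + expm1 y v ^ 2] is bounded below, so the growth of order
    [1 + S] of the left-hand side is absorbed by a multiple of [S ^ 2]. *)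
Lemma quadratic_expansion (g1 g2 : nat) (f fx fy fxx fxy fyy : R * R -> R) (x y : R)
    (eps : posreal) :
  bounded_on quadrant (fun p => omega2 g1 g2 p * f p) ->
  is_partial_x f fx -> is_partial_x fx fxx ->
  is_partial_y f fy -> is_partial_y fy fyy -> is_partial_x fy fxy ->
  continuous_on quadrant fxx -> continuous_on quadrant fxy ->
  continuous_on quadrant fyy -> 0 <= x -> 0 <= y ->
  exists M : R, forall u v, 0 <= u -> 0 <= v ->
    Rabs (f (u, v) - f (x, y) - jet2 (fx (x, y)) (fy (x, y)) (fxx (x, y) - fx (x, y))
       (fxy (x, y)) (fyy (x, y) - fy (x, y)) x y (u, v))
    <= eps * (expm1 x u ^ 2 + expm1 y v ^ 2)
       + M * (expm1 x u ^ 4 + expm1 y v ^ 4).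
Proof.
  intros Hf Hx Hxx Hy Hyy Hxy Cxx Cxy Cyy x0 y0.
  destruct (quadratic_expansion_local f fx fy fxx fxy fyy x y eps) as [d' Hloc]; trivial.
  set (d := Rmin d' 1).
  assert (Hd : 0 < d <= 1).
  { split; [apply Rmin_glb_lt; [apply cond_pos|lra]|apply Rmin_r]. }
  assert (Hdd : d <= d') by apply Rmin_l.
  destruct (weighted_growth g1 g2 f Hf) as [K0 [HK0 HK]].
  set (K1 := Rabs (fx (x, y)) + Rabs (fy (x, y)) + Rabs ((fxx (x, y) - fx (x, y)) / 2)
    + Rabs (fxy (x, y)) + Rabs ((fyy (x, y) - fy (x, y)) / 2)).
  assert (HK1 : 0 <= K1) by (unfold K1; repeat apply Rplus_le_le_0_compat; apply Rabs_pos).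
  set (K := K0 * (exp x * exp y) * 2 + Rabs (f (x, y)) + K1).
  pose proof (exp_pos x) as ex. pose proof (exp_pos y) as ey.
  assert (HKp : 0 <= K0 * (exp x * exp y)).
  { apply Rmult_le_pos; [exact HK0|]. apply Rmult_le_pos; lra. }
  assert (HKK : 0 <= K) by (unfold K; pose proof (Rabs_pos (f (x, y))); lra).
  set (q := d ^ 2 / 4). assert (Hq : 0 < q) by (unfold q; nra).
  exists (2 * K * (/ q ^ 2 + / q)). intros u v Hu Hv.
  set (w := expm1 x u). set (z := expm1 y v).
  set (S := w ^ 2 + z ^ 2).
  assert (HS : 0 <= S) by (unfold S; pose proof (pow2_ge_0 w); pose proof (pow2_ge_0 z); lra).
  assert (HS4 : S ^ 2 <= 2 * (w ^ 4 + z ^ 4)).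
  { unfold S. pose proof (pow2_ge_0 (w ^ 2 - z ^ 2)). lra. }
  assert (Hq1 : 0 < / q ^ 2 + / q).
  { apply Rplus_lt_0_compat; apply Rinv_0_lt_compat; trivial. now apply pow_lt. }
  assert (HM : 0 <= 2 * K * (/ q ^ 2 + / q) * (w ^ 4 + z ^ 4)).
  { pose proof (pow2_ge_0 S). repeat apply Rmult_le_pos; lra. }
  pose proof (cond_pos eps) as He.
  assert (Hfar : q <= S ->
    Rabs (f (u, v) - f (x, y) - jet2 (fx (x, y)) (fy (x, y)) (fxx (x, y) - fx (x, y))
       (fxy (x, y)) (fyy (x, y) - fy (x, y)) x y (u, v))
    <= eps * S + 2 * K * (/ q ^ 2 + / q) * (w ^ 4 + z ^ 4)).
  { intros HSq.
    pose proof (jet2_growth (fx (x, y)) (fy (x, y)) (fxx (x, y) - fx (x, y))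
      (fxy (x, y)) (fyy (x, y) - fy (x, y)) x y u v) as HJ.
    fold K1 w z S in HJ. specialize (HK u v Hu Hv).
    (* By definition [exp u = exp x * (1 + w)] and [exp v = exp y * (1 + z)]. *)
    assert (Huv : exp u * exp v <= (exp x * exp y) * (2 * (1 + S))).
    { replace (exp u * exp v) with ((exp x * exp y) * ((1 + w) * (1 + z))).
      - apply Rmult_le_compat_l; [apply Rmult_le_pos; lra|].
        unfold S. pose proof (pow2_ge_0 (w - z)).
        pose proof (pow2_ge_0 (w - 1)). pose proof (pow2_ge_0 (z - 1)). nra.
      - replace u with (x + (u - x)) at 1 by ring.
        replace v with (y + (v - y)) at 1 by ring.
        rewrite !exp_plus. unfold w, z, expm1. ring. }
    assert (HB : Rabs (f (u, v) - f (x, y) - jet2 (fx (x, y)) (fy (x, y))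
      (fxx (x, y) - fx (x, y)) (fxy (x, y)) (fyy (x, y) - fy (x, y)) x y (u, v))
      <= K * (1 + S)).
    { eapply Rle_trans; [apply Rabs_triang|]. rewrite Rabs_Ropp.
      eapply Rle_trans;
        [apply Rplus_le_compat_r; eapply Rle_trans; [apply Rabs_triang|];
         rewrite Rabs_Ropp; apply Rle_refl|].
      assert (Rabs (f (u, v)) <= K0 * ((exp x * exp y) * (2 * (1 + S)))).
      { eapply Rle_trans; [exact HK|]. now apply Rmult_le_compat_l. }
      assert (0 <= Rabs (f (x, y)) * S) by (apply Rmult_le_pos; trivial; apply Rabs_pos).
      unfold K. lra. }
    assert (HS1 : 1 + S <= S ^ 2 * (/ q ^ 2 + / q)).
    { assert (Hr : 1 <= S * / q).
      { apply Rmult_le_reg_r with q; [exact Hq|].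
        rewrite Rmult_assoc, Rinv_l, Rmult_1_r; lra. }
      replace (S ^ 2 * (/ q ^ 2 + / q)) with ((S * / q) * (S * / q) + S * (S * / q))
        by (field; lra).
      nra. }
    assert (0 <= eps * S) by (apply Rmult_le_pos; lra).
    apply Rle_trans with (K * (S ^ 2 * (/ q ^ 2 + / q))).
    - eapply Rle_trans; [exact HB|]. now apply Rmult_le_compat_l.
    - assert (K * (S ^ 2 * (/ q ^ 2 + / q)) <=
        K * ((2 * (w ^ 4 + z ^ 4)) * (/ q ^ 2 + / q))).
      { apply Rmult_le_compat_l; [exact HKK|].
        apply Rmult_le_compat_r; [lra|exact HS4]. }
      lra. }
  destruct (Rlt_dec (Rabs (u - x)) d) as [Hux|Hux];
    [destruct (Rlt_dec (Rabs (v - y)) d) as [Hvy|Hvy]|].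
  - specialize (Hloc u v Hu Hv ltac:(lra) ltac:(lra)). fold w z S in Hloc. lra.
  - apply Hfar.
    pose proof (expm1_far y v d ltac:(lra) ltac:(lra)) as HF. fold z in HF.
    unfold q, S. rewrite <- (pow2_abs z). pose proof (pow2_ge_0 w). nra.
  - apply Hfar.
    pose proof (expm1_far x u d ltac:(lra) ltac:(lra)) as HF. fold w in HF.
    unfold q, S. rewrite <- (pow2_abs w). pose proof (pow2_ge_0 z). nra.
Qed.

(** * The limit *)

(** Positivity applied to the expansion with error [eps]: the quadratic error
    terms survive with the factor [eps], the quartic ones vanish because means
    of fourth powers are [o(1 / n)], and so does the mixed term, whose mean is a
    product of two means of order [1 / n]. *)
Lemma kantorovich_upper_lower (a x y eps M A B C D E : R) (f : R * R -> R) :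
  0 <= a -> 0 <= x -> 0 <= y -> continuous_on quadrant f ->
  (forall u v, 0 <= u -> 0 <= v ->
    Rabs (f (u, v) - f (x, y) - jet2 A B C D E x y (u, v))
    <= eps * (expm1 x u ^ 2 + expm1 y v ^ 2)
       + M * (expm1 x u ^ 4 + expm1 y v ^ 4)) ->
  let L := A * drift a x + (A + C) / 2 * diffusion x
           + (B * drift a y + (B + E) / 2 * diffusion y) in
  exists lo up : nat -> R,
    eventually (fun n => lo n <= INR n * (kantorovich a n n f x y - f (x, y)) <= up n) /\
    is_lim_seq lo (L - eps * (diffusion x + diffusion y)) /\
    is_lim_seq up (L + eps * (diffusion x + diffusion y)).
Proof.
  intros Ha Hx Hy Hf Hb L.
  destruct (quartic_mean a x A (C / 2 + eps) M Ha Hx) as [ux [Ux1 Ux2]].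
  destruct (quartic_mean a y B (E / 2 + eps) M Ha Hy) as [uy [Uy1 Uy2]].
  destruct (quartic_mean a x A (C / 2 - eps) (- M) Ha Hx) as [lx [Lx1 Lx2]].
  destruct (quartic_mean a y B (E / 2 - eps) (- M) Ha Hy) as [ly [Ly1 Ly2]].
  destruct (quartic_mean a x 1 0 0 Ha Hx) as [wx [Wx1 Wx2]].
  destruct (quartic_mean a y 1 0 0 Ha Hy) as [wy [Wy1 Wy2]].
  assert (Hmix : is_lim_seq (fun n => D * (INR n * wx n * wy n)) 0).
  { apply is_lim_seq_value with
      (D * ((1 * drift a x + (1 / 2 + 0) * diffusion x) * 0)); [|ring].
    apply is_lim_seq_mult'; [apply is_lim_seq_const|].
    apply is_lim_seq_mult'; [exact Wx2|].
    eapply is_lim_seq_0_of_rescaled, Wy2. }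
  exists (fun n => INR n * lx n + INR n * ly n + D * (INR n * wx n * wy n)).
  exists (fun n => INR n * ux n + INR n * uy n + D * (INR n * wx n * wy n)).
  split; [|split].
  - generalize (filter_and _ _ (filter_and _ _ Ux1 Uy1)
      (filter_and _ _ (filter_and _ _ Lx1 Ly1) (filter_and _ _ Wx1 Wy1))).
    apply filter_imp. intros n ([H1 H2] & [H3 H4] & [H5 H6]).
    assert (Hw : forall z m, is_mean a n z
        (fun u => 1 * expm1 z u + 0 * expm1 z u ^ 2 + 0 * expm1 z u ^ 4) m ->
      is_mean a n z (expm1 z) m).
    { intros z m. apply is_mean_ext. intros u. ring. }
    pose proof (is_mean_plus _ _ _ _ _ _ _ (is_mean_const a x (f (x, y)) n Ha Hx) H1) as H1'.
    pose proof (is_mean_plus _ _ _ _ _ _ _ (is_mean_const a x (f (x, y)) n Ha Hx) H3) as H3'.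
    pose proof (kantorovich_bounds a n x y D f _ _ _ _ _ _ _ _ _ _ _ _ Ha Hx Hy Hf
      H3' H4 H1' H2 (Hw _ _ H5) (Hw _ _ H6)) as HK.
    assert (HK' : f (x, y) + lx n + ly n + D * (wx n * wy n)
      <= kantorovich a n n f x y <= f (x, y) + ux n + uy n + D * (wx n * wy n)).
    { apply HK. intros [u v] [Hu Hv].
      specialize (Hb u v Hu Hv). apply Rabs_le_between in Hb.
      unfold jet2, separable, jet in *; simpl fst in *; simpl snd in *. lra. }
    pose proof (pos_INR n) as Hn.
    replace (INR n * lx n + INR n * ly n + D * (INR n * wx n * wy n))
      with (INR n * (lx n + ly n + D * (wx n * wy n))) by ring.
    replace (INR n * ux n + INR n * uy n + D * (INR n * wx n * wy n))
      with (INR n * (ux n + uy n + D * (wx n * wy n))) by ring.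
    split; apply Rmult_le_compat_l; lra.
  - eapply is_lim_seq_value;
      [apply is_lim_seq_plus'; [apply is_lim_seq_plus'|]; eassumption|].
    unfold L. field.
  - eapply is_lim_seq_value;
      [apply is_lim_seq_plus'; [apply is_lim_seq_plus'|]; eassumption|].
    unfold L. field.
Qed.

Theorem theorem5 (a : R) (g1 g2 : nat) (f : R * R -> R)
    (ha : 0 <= a) (hf : in_Cm 2 g1 g2 f) (x y : R) (hxy : quadrant (x, y)) :
  is_lim_seq (fun n => INR n * (kantorovich a n n f x y - f (x, y)))
    (Finite
       ((- x + a * x / (1 + x) + 1 / 2) * partial_x f (x, y) +
        (- y + a * y / (1 + y) + 1 / 2) * partial_y f (x, y) +
        x / 2 * (x + 1) * partial_x (partial_x f) (x, y) +
        y / 2 * (y + 1) * partial_y (partial_y f) (x, y))).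
Proof.
  destruct hxy as [hx hy]; simpl in hx, hy.
  destruct hf as [[Cf [Bf _]] Hd].
  destruct (Hd 1%nat 1%nat ltac:(lia) ltac:(lia)) as [[_ Hx] _].
  destruct (Hd 1%nat 0%nat ltac:(lia) ltac:(lia)) as [[Hy _] _].
  destruct (Hd 2%nat 2%nat ltac:(lia) ltac:(lia)) as [[_ Hxx] [Cxx _]].
  destruct (Hd 2%nat 1%nat ltac:(lia) ltac:(lia)) as [[_ Hxy] [Cxy _]].
  destruct (Hd 2%nat 0%nat ltac:(lia) ltac:(lia)) as [[Hyy _] [Cyy _]].
  assert (Px : is_partial_x f (partial_x f)).
  { apply partial_x_correct. intros p. apply (Hx 0%nat). lia. }
  assert (Py : is_partial_y f (partial_y f)).
  { apply partial_y_correct. intros p. apply (Hy 0%nat). lia. }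
  assert (Pxx : is_partial_x (partial_x f) (partial_x (partial_x f))).
  { apply partial_x_correct. intros p. apply (Hxx 1%nat). lia. }
  assert (Pyy : is_partial_y (partial_y f) (partial_y (partial_y f))).
  { apply partial_y_correct. intros p. apply (Hyy 1%nat). lia. }
  assert (Pxy : is_partial_x (partial_y f) (partial_x (partial_y f))).
  { apply partial_x_correct. intros p. apply (Hxy 0%nat). lia. }
  set (s := diffusion x + diffusion y).
  assert (Hs : 0 <= s).
  { unfold s, diffusion. pose proof (Rmult_le_pos x (x + 1)).
    pose proof (Rmult_le_pos y (y + 1)). lra. }
  apply is_lim_seq_spec. intros eps.
  assert (He : 0 < eps / (2 * (s + 1))).
  { apply Rdiv_lt_0_compat; [apply cond_pos|lra]. }
  assert (Hes : eps / (2 * (s + 1)) * s < eps / 2).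
  { pose proof (cond_pos eps).
    apply Rmult_lt_reg_r with (2 * (s + 1)); [lra|].
    replace (eps / (2 * (s + 1)) * s * (2 * (s + 1))) with (eps * s) by (field; lra).
    nra. }
  destruct (quadratic_expansion g1 g2 f _ _ _ _ _ x y (mkposreal _ He) Bf Px Pxx Py
    Pyy Pxy Cxx Cxy Cyy hx hy) as [M HM].
  destruct (kantorovich_upper_lower a x y _ M _ _ _ _ _ f ha hx hy Cf HM)
    as (lo & up & Hb & Hlo & Hup).
  simpl pos in Hlo, Hup. fold s in Hlo, Hup.
  apply is_lim_seq_spec in Hlo. apply is_lim_seq_spec in Hup.
  generalize (filter_and _ _ Hb (filter_and _ _ (Hlo (pos_div_2 eps)) (Hup (pos_div_2 eps)))).
  apply filter_imp. simpl. intros n ([B1 B2] & H1 & H2).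
  apply Rabs_lt_between in H1. apply Rabs_lt_between in H2.
  apply Rabs_lt_between.
  unfold drift, diffusion in H1, H2.
  lra.
Qed.
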